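(* Let $\psi\in{\rm LFP}$, and let $\pi\colon\mathrm{Lit}_A(\tau)\rightarrow K$ be a $K$-interpretation into an absorptive, fully continuous semiring $K$. Then $\pi [\![ \psi ]\!] = \bigsqcup \{ \pi [\![ {\cal S} ]\!] \mid {\cal S} \in \mathrm{Strat}(\psi) \}$.
   Context: Semirings are commutative and naturally ordered; $\bigsqcup$ and $\inf$ denote suprema and infima in the natural order. $K$ is fully continuous if every chain has a supremum and infimum and $+,\cdot$ preserve suprema and infima of nonempty chains in each argument; absorptive if $a+ab=a$ for all $a,b$. For a finite universe $A$ and relational vocabulary $\tau$, $\mathrm{Lit}_A(\tau)$ is the set of atoms $R\bar a$, negated atoms $\neg R\bar a$, equalities and inequalities over $A$; a $K$-interpretation maps literals to $K$, true (in)equalities to $1$ and false ones to $0$. The provenance value $\pi[\![\psi]\!]$ of an LFP-sentence (LFP = first-order logic with least and greatest fixed-point operators $[\mathrm{lfp}\, R\bar x.\phi](\bar a)$, $[\mathrm{gfp}\, R\bar x.\phi](\bar a)$, $R$ positive in $\phi$) is defined inductively: $\vee,\exists$ via $+$, $\wedge,\forall$ via $\cdot$, negation via the negation normal form, and fixed-point formulae via the least/greatest fixed point of the update operator $g \mapsto (\bar a \mapsto \pi[R\mapsto g][\![\phi(R,\bar a)]\!])$ on functions $A^{m}\to K$ ordered pointwise. The model-checking game for $\psi$ (in negation normal form) on $A$ is a parity game whose positions are subformulae instantiated with elements of $A$: Verifier moves at disjunctions and existential quantifiers, Falsifier at conjunctions and universal quantifiers, positions $[\mathrm{fp}\,R\bar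 x.\phi](\bar a)$ and $R\bar a$ move to $\phi(\bar a)$; terminal positions are literals. Fixed-point variables get priorities (even for gfp, odd for lfp, nondecreasing along dependencies) and an infinite play is won by Verifier iff the least priority seen infinitely often is even. $\mathrm{Strat}(\psi)$ is the set of all (not necessarily positional) Verifier strategies from position $\psi$. For a strategy ${\cal S}$ and literal $L$, $\#_{\cal S}(L)\in{\mathbb N}\cup\{\infty\}$ is the number of plays consistent with ${\cal S}$ with outcome $L$, and $\pi[\![{\cal S}]\!] = \prod_{L\in\mathrm{Lit}_A(\tau)} \pi(L)^{\#_{\cal S}(L)}$ if all infinite plays consistent with ${\cal S}$ are won by Verifier, and $0$ otherwise, where $a^\infty := \inf_{n<\omega} a^n$. *)

(* Defs.v *)
From HB Require Import structures.
From mathcomp Require Import all_boot all_order all_algebra.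
From mathcomp Require Import finmap boolp classical_sets functions cardinality fsbigop.

Set Implicit Arguments.
Unset Strict Implicit.
Unset Printing Implicit Defensive.

Import GRing.Theory.
Local Open Scope classical_set_scope.
Local Open Scope ring_scope.

(** * Naturally ordered commutative semirings *)

Section NaturalOrder.
Variable K : comPzSemiRingType.
Implicit Types (a b s u x y : K) (C S : set K).

Definition nle a b : Prop := exists c, a + c = b.

Definition is_sup S s : Prop :=
  (forall x, S x -> nle x s) /\
  (forall u, (forall x, S x -> nle x u) -> nle s u).

Definition is_inf S s : Prop :=
  (forall x, S x -> nle s x) /\
  (forall u, (forall x, S x -> nle u x) -> nle u s).

Definition chain C : Prop :=
  forall x y, C x -> C y -> nle x y \/ nle y x.

(** The default value [0] is never used when the infimum exists, in particular
    when [K] is absorptive (the powers of [a] then form a chain) and fully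
    continuous. *)
Definition infpow a : K := xget 0 [set s | is_inf (range (fun n => a ^+ n)) s].

(** Exponents in N + {oo}; [None] is the infinite exponent. *)
Definition epow a (k : option nat) : K :=
  if k is Some n then a ^+ n else infpow a.

Section FixedPoints.
Variables (I : finType) (F : {ffun I -> K} -> {ffun I -> K}).
Implicit Types g h : {ffun I -> K}.

Definition fle g h : Prop := forall i, nle (g i) (h i).

Definition is_lfp g : Prop := F g = g /\ forall h, F h = h -> fle g h.
Definition is_gfp g : Prop := F g = g /\ forall h, F h = h -> fle h g.

Definition lfp : {ffun I -> K} := xget [ffun=> 0] [set g | is_lfp g].
Definition gfp : {ffun I -> K} := xget [ffun=> 0] [set g | is_gfp g].
End FixedPoints.

End NaturalOrder.

Definition naturally_ordered (K : comPzSemiRingType) : Prop :=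
  forall a b : K, nle a b -> nle b a -> a = b.

Definition absorptive (K : comPzSemiRingType) : Prop :=
  forall a b : K, a + a * b = a.

(** Since [+] and [*] are commutative, it suffices to state preservation in the
    second argument. *)
Definition fully_continuous (K : comPzSemiRingType) : Prop :=
  [/\ forall C : set K, chain C -> exists s, is_sup C s,
      forall C : set K, chain C -> exists s, is_inf C s,
      forall (C : set K) (a s : K), chain C -> C !=set0 -> is_sup C s ->
        is_sup [set a + x | x in C] (a + s) /\
        is_sup [set a * x | x in C] (a * s) &
      forall (C : set K) (a s : K), chain C -> C !=set0 -> is_inf C s ->
        is_inf [set a + x | x in C] (a + s) /\
        is_inf [set a * x | x in C] (a * s)].

(** * Fixed-point logic *)

Inductive fixkind := Lfp | Gfp.

Definition dual (k : fixkind) : fixkind :=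
  match k with Lfp => Gfp | Gfp => Lfp end.

(** Extension of a family over the relation variables [V] (with arities [va])
    to one more relation variable [None] of arity [m]. *)
Definition ext (F : nat -> Type) (V : Type) (va : V -> nat) (m : nat)
    (x : F m) (e : forall v, F (va v)) : forall v, F (oapp va m v) :=
  fun v => match v with Some w => e w | None => x end.

Definition of_none (F : void -> Type) : forall v, F v :=
  fun v => match v with end.
Arguments of_none : clear implicits.

Section Syntax.
(** A relational vocabulary, not necessarily finite. *)
Variables (tau : choiceType) (ar : tau -> nat).

(** Relational atoms and equations over the set [T] of terms; literals are
    atoms with a sign, [false] standing for negation. *)
Definition atom (T : Type) : Type := ({R : tau & (ar R).-tuple T} + T * T)%type.
Definition literal (T : Type) : Type := (bool * atom T)%type.

(** [formula va n] has its free relation variables in [V], with arities given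
    by [va], and its free first-order variables in ['I_n].  First-order
    variables are de Bruijn indices: a quantifier binds index [0], and
    [Fix k m f t], i.e. [fp R x_0 .. x_(m-1) . f](t), binds the indices [< m]
    together with the relation variable [None] of arity [m].  The body [f] may
    have further free first-order variables (parameters). *)
Inductive formula (V : Type) (va : V -> nat) (n : nat) : Type :=
| Atom of atom 'I_n
| RVar (v : V) of (va v).-tuple 'I_n
| Neg of formula va n
| And of formula va n & formula va n
| Or of formula va n & formula va n
| Ex of formula va n.+1
| All of formula va n.+1
| Fix (k : fixkind) (m : nat) of formula (oapp va m) (m + n) & m.-tuple 'I_n.

(** [positive f pol b]: with [b] the parity of the number of negations above
    [f] and [pol v] the same parity at the binder of [v], every occurrence of a
    relation variable is below an even number of negations within the scope of
    its binder. *)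
Fixpoint positive V (va : V -> nat) n (f : formula va n)
    (pol : V -> bool) (b : bool) : bool :=
  match f with
  | Atom _ => true
  | RVar v _ => pol v == b
  | Neg f1 => positive f1 pol (~~ b)
  | And f1 f2 | Or f1 f2 => positive f1 pol b && positive f2 pol b
  | Ex f1 | All f1 => positive f1 pol b
  | Fix _ _ f1 _ => positive f1 (oapp pol b) b
  end.

Definition no_rvar : void -> nat := of_none _.

(** LFP-formulae without free relation variables; sentences are the case
    [n = 0]. *)
Record LFP (n : nat) := MkLFP {
  lfp_formula :> formula no_rvar n;
  lfp_positive : positive lfp_formula (of_none _) false
}.

(** Formulae in negation normal form. *)
Inductive nform (V : Type) (va : V -> nat) (n : nat) : Type :=
| NLit of literal 'I_n
| NVar (v : V) of (va v).-tuple 'I_n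
| NAnd of nform va n & nform va n
| NOr of nform va n & nform va n
| NEx of nform va n.+1
| NAll of nform va n.+1
| NFix (k : fixkind) (m : nat) of nform (oapp va m) (m + n) & m.-tuple 'I_n.

(** [nnf true f] is the normal form of [f] and [nnf false f] that of its
    negation.  The negation of [lfp R x. f](t) is [gfp R x. ~ f[~ R / R]](t),
    so that, [R] being positive in [f], its occurrences end up unnegated. *)
Fixpoint nnf V (va : V -> nat) n (b : bool) (f : formula va n) : nform va n :=
  match f with
  | Atom a => NLit va (b, a)
  | RVar v t => NVar t
  | Neg f1 => nnf (~~ b) f1
  | And f1 f2 =>
      if b then NAnd (nnf b f1) (nnf b f2) else NOr (nnf b f1) (nnf b f2)
  | Or f1 f2 =>
      if b then NOr (nnf b f1) (nnf b f2) else NAnd (nnf b f1) (nnf b f2)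
  | Ex f1 => if b then NEx (nnf b f1) else NAll (nnf b f1)
  | All f1 => if b then NAll (nnf b f1) else NEx (nnf b f1)
  | Fix k _ f1 t => NFix (if b then k else dual k) (nnf b f1) t
  end.

(** The fixed-point variables of a formula, i.e. the occurrences of
    fixed-point operators in it. *)
Fixpoint fpvar V (va : V -> nat) n (f : nform va n) : Type :=
  match f with
  | NLit _ | NVar _ _ => void
  | NAnd f1 f2 | NOr f1 f2 => (fpvar f1 + fpvar f2)%type
  | NEx f1 | NAll f1 => fpvar f1
  | NFix _ _ f1 _ => option (fpvar f1)
  end.

Fixpoint occurs V (va : V -> nat) n (f : nform va n) (v : V) : Prop :=
  match f with
  | NLit _ => False
  | NVar w _ => w = v
  | NAnd f1 f2 | NOr f1 f2 => occurs f1 v \/ occurs f2 v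
  | NEx f1 | NAll f1 => occurs f1 v
  | NFix _ _ f1 _ => occurs f1 (Some v)
  end.

(** Admissible priorities [pr] for the fixed-point variables of [f], given the
    priorities [vpr] of its free relation variables: odd for least and even for
    greatest fixed points, and at most the priority of [S] for any variable on
    which [S] depends, i.e. which is free in the formula defining [S]. *)
Fixpoint admissible V (va : V -> nat) n (f : nform va n) (vpr : V -> nat) :
    (fpvar f -> nat) -> Prop :=
  match f with
  | NLit _ | NVar _ _ => fun _ => True
  | NAnd f1 f2 | NOr f1 f2 => fun pr =>
      admissible vpr (pr \o inl) /\ admissible vpr (pr \o inr)
  | NEx f1 | NAll f1 => fun pr => @admissible _ _ _ f1 vpr pr
  | NFix k _ f1 _ => fun pr =>
      [/\ odd (pr None) = (if k is Lfp then true else false),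
          forall v, occurs f1 (Some v) -> (vpr v <= pr None)%N &
          admissible (oapp vpr (pr None)) (pr \o Some)]
  end.

End Syntax.

(** Terms are variables; [inst rho t] instantiates the tuple [t] by [rho]. *)
Definition inst (A : Type) n m (rho : n.-tuple A) (t : m.-tuple 'I_n) :
  m.-tuple A := map_tuple (tnth rho) t.

Definition inst_lit (tau : choiceType) (ar : tau -> nat) (A : Type) n
    (rho : n.-tuple A) (l : literal ar 'I_n) : literal ar A :=
  (l.1, match l.2 with
        | inl (existT R t) => inl (existT _ R (inst rho t))
        | inr (i, j) => inr (tnth rho i, tnth rho j)
        end).

(** * Provenance semantics *)

Section Semantics.
Variables (tau : choiceType) (ar : tau -> nat) (A : finType).
Variable K : comPzSemiRingType.

Definition interpretation (pi : literal ar A -> K) : Prop :=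
  forall (b : bool) (x y : A),
    pi (b, inr (x, y)) = if b == (x == y) then 1 else 0.

Variable pi : literal ar A -> K.

(** [e] interprets the free relation variables.  When [K] is absorptive and
    fully continuous, the fixed points below exist, as update operators are
    monotone. *)
Fixpoint eval V (va : V -> nat) n (f : nform ar va n) (rho : n.-tuple A)
    (e : forall v, {ffun (va v).-tuple A -> K}) : K :=
  match f with
  | NLit l => pi (inst_lit rho l)
  | NVar v t => e v (inst rho t)
  | NAnd f1 f2 => eval f1 rho e * eval f2 rho e
  | NOr f1 f2 => eval f1 rho e + eval f2 rho e
  | NEx f1 => \sum_(a : A) eval f1 [tuple of a :: rho] e
  | NAll f1 => \prod_(a : A) eval f1 [tuple of a :: rho] e
  | NFix k m f1 t =>
      let update (g : {ffun m.-tuple A -> K}) : {ffun m.-tuple A -> K} :=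
        [ffun a : m.-tuple A => eval f1 [tuple of a ++ rho]
           (ext (F := fun j => {ffun j.-tuple A -> K}) g e)] in
      (if k is Lfp then lfp update else gfp update) (inst rho t)
  end.

Definition prov n (psi : LFP ar n) (rho : n.-tuple A) : K :=
  eval (nnf true psi) rho (of_none _).

End Semantics.

(** * Parity games with outcomes in a set [L] *)

Inductive player := Verifier | Falsifier.

(** The local data at a position: an outcome at terminal positions, the player
    to move and the possible moves, or a forced move from a position carrying a
    priority.  Positions of the first two kinds have no priority, i.e. they are
    ignored by the winning condition. *)
Inductive node (L P : Type) : Type :=
| Terminal of L
| Move of player & seq P
| Prio of nat & P.
Arguments Terminal {L P}.
Arguments Move {L P}.
Arguments Prio {L P}.

Definition verifier_node L P (x : node L P) : bool :=
  if x is Move Verifier _ then true else false.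
Definition succs L P (x : node L P) : seq P :=
  match x with Terminal _ => [::] | Move _ s => s | Prio _ q => [:: q] end.
Definition priority L P (x : node L P) : option nat :=
  if x is Prio c _ then Some c else None.

Record game (L : choiceType) := Game {
  position : finType;
  start : position;
  node_at : position -> node L position
}.

Section Games.
Variables (L : choiceType) (G : game L).
Implicit Types (h : seq (position G)) (p q : position G).

Definition edge p q : bool := q \in succs (node_at p).
Definition is_verifier p : bool := verifier_node (node_at p).

(** A history [h] stands for the finite play [start G :: h]. *)
Definition current h : position G := last (start G) h.

Inductive consistent (sigma : seq (position G) -> position G) :
  seq (position G) -> Prop :=
| consistent_nil : consistent sigma [::]
| consistent_rcons h q :
    consistent sigma h -> edge (current h) q ->
    (is_verifier (current h) -> q = sigma h) ->
    consistent sigma (rcons h q).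

(** Verifier strategies from the start position, with arbitrary memory. *)
Record strategy := Strategy {
  choice_of :> seq (position G) -> position G;
  choice_legal : forall h, consistent choice_of h -> is_verifier (current h) ->
    edge (current h) (choice_of h)
}.

Variable S : strategy.

Definition infinite_play (f : nat -> position G) : Prop :=
  f 0%N = start G /\
  forall n, consistent S (mkseq (fun i => f i.+1) n).

Definition infinitely_often (f : nat -> position G) (c : nat) : Prop :=
  forall n, exists2 k, (n <= k)%N & priority (node_at (f k)) = Some c.

Definition won_by_verifier (f : nat -> position G) : Prop :=
  exists c, [/\ ~~ odd c, infinitely_often f c &
    forall c', (c' < c)%N -> ~ infinitely_often f c'].

Definition plays_to (l : L) : set (seq (position G)) :=
  [set h | consistent S h /\ node_at (current h) = Terminal l].

(** The number of consistent plays with outcome [l], [None] if infinite. *)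
Definition nplays (l : L) : option nat :=
  if `[< finite_set (plays_to l) >] then Some #|` fset_set (plays_to l)|
  else None.

(** The product is over all [l : L]; only finitely many factors differ from
    [1], as [position G] is finite. *)
Definition strategy_value (K : comPzSemiRingType) (pi : L -> K) : K :=
  if `[< forall f, infinite_play f -> won_by_verifier f >] then
    \big[*%R/1]_(l \in [set: L]) epow (pi l) (nplays l)
  else 0.

End Games.

(** * Model-checking games *)

Section ModelChecking.
Variables (tau : choiceType) (ar : tau -> nat) (A : finType).

(** [option (inner f)] is the type of instantiated subformulae of [f]: an
    occurrence of a subformula, together with values for the variables bound
    between the root of [f] and this occurrence; [None] is [f] itself.
    Different occurrences of the same subformula are thus different
    positions, which matters for the number of plays. *)
Fixpoint inner V (va : V -> nat) n (f : nform ar va n) : finType :=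
  match f with
  | NLit _ | NVar _ _ => void
  | NAnd f1 f2 | NOr f1 f2 => (option (inner f1) + option (inner f2))%type
  | NEx f1 | NAll f1 => (A * option (inner f1))%type
  | NFix _ m f1 _ => (m.-tuple A * option (inner f1))%type
  end.

(** The part of a game on [P] that consists of the positions of [f]
    instantiated by [rho]: [inj] embeds these positions into [P], [jump v a] is
    the target of the move from the position [v a] for a free relation variable
    [v], and [vpr] and [pr] are the priorities of the free and bound relation
    variables.  Forced moves from fixed-point formulae are, immaterially,
    attributed to Falsifier. *)
Fixpoint mc_node (P : Type) V (va : V -> nat) n (f : nform ar va n)
    (rho : n.-tuple A) (vpr : V -> nat)
    (jump : forall v, (va v).-tuple A -> P) :
    (fpvar f -> nat) -> (option (inner f) -> P) -> option (inner f) ->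
    node (literal ar A) P :=
  match f with
  | NLit l => fun _ _ _ => Terminal (inst_lit rho l)
  | NVar v t => fun _ _ _ => Prio (vpr v) (jump v (inst rho t))
  | NAnd f1 f2 => fun pr inj p =>
      match p with
      | None =>
          Move Falsifier [:: inj (Some (inl None)); inj (Some (inr None))]
      | Some (inl q) => mc_node rho vpr jump (pr \o inl) (inj \o Some \o inl) q
      | Some (inr q) => mc_node rho vpr jump (pr \o inr) (inj \o Some \o inr) q
      end
  | NOr f1 f2 => fun pr inj p =>
      match p with
      | None =>
          Move Verifier [:: inj (Some (inl None)); inj (Some (inr None))]
      | Some (inl q) => mc_node rho vpr jump (pr \o inl) (inj \o Some \o inl) q
      | Some (inr q) => mc_node rho vpr jump (pr \o inr) (inj \o Some \o inr) q
      end
  | NEx f1 => fun pr inj p =>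
      match p with
      | None => Move Verifier [seq inj (Some (a, None)) | a <- enum A]
      | Some (a, q) => @mc_node P _ _ _ f1 [tuple of a :: rho] vpr jump pr
                         (fun q' => inj (Some (a, q'))) q
      end
  | NAll f1 => fun pr inj p =>
      match p with
      | None => Move Falsifier [seq inj (Some (a, None)) | a <- enum A]
      | Some (a, q) => @mc_node P _ _ _ f1 [tuple of a :: rho] vpr jump pr
                         (fun q' => inj (Some (a, q'))) q
      end
  | NFix k m f1 t => fun pr inj p =>
      match p with
      | None => Move Falsifier [:: inj (Some (inst rho t, None))]
      | Some (a, q) =>
          mc_node [tuple of a ++ rho] (oapp vpr (pr None))
            (ext (F := fun j => j.-tuple A -> P)
                 (fun a' => inj (Some (a', None))) jump)
            (pr \o Some) (fun q' => inj (Some (a, q'))) q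
      end
  end.

Section Game.
Variables (n : nat) (psi : LFP ar n).

Definition admissible_priorities (pr : fpvar (nnf true psi) -> nat) : Prop :=
  admissible (of_none _) pr.

Definition mc_game (rho : n.-tuple A) (pr : fpvar (nnf true psi) -> nat) :
    game (literal ar A) :=
  Game (position := option (inner (nnf true psi))) None
    (mc_node rho (of_none _) (of_none _)
       pr id).

(** [Strat(psi)], for [psi] instantiated by [rho]. *)
Definition Strat (rho : n.-tuple A) (pr : fpvar (nnf true psi) -> nat) : Type :=
  strategy (mc_game rho pr).

End Game.
End ModelChecking.

(* Main.v *)
Require Import Defs.
From mathcomp Require Import all_boot all_order all_algebra.
From mathcomp Require Import finmap boolp classical_sets functions cardinality fsbigop.

Set Implicit Arguments.
Unset Strict Implicit.
Unset Printing Implicit Defensive.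

Import GRing.Theory.
Local Open Scope classical_set_scope.
Local Open Scope ring_scope.

(** Strategies are represented by the trees of their consistent histories, and
    subformulae with free relation variables by games that stop at a set [E] of
    exits.  By induction on the formula, its value is the supremum of the values
    of the winning strategies of its game, and finitely many of these strategies
    suffice, uniformly in the values of the exits.  For a fixed-point formula, a
    strategy is cut at its visits to the fixed-point variable; this shows that
    its value is below the fixed point, by coinduction for [gfp] and, for [lfp],
    because the visits along a winning play are finite in number.

    Conversely, the positions [y] of the fixed-point variable are eliminated one
    at a time.  By absorption one may replace the equation for [y] by an affine
    one, [x = b + c x], where [b] sums the strategies without an exit to [y].  Its
    least solution is [b]; its greatest solution [b + c^oo] is realised by
    restarting a strategy at each of its exits to [y].  The solution is then
    substituted in the other strategies: if such a strategy has finitely many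
    exits to [y], a continuation is chosen for each of them, and if it has
    infinitely many, the same continuation is chosen for all, since
    [(a + b)^oo = a^oo + b^oo]. *)

Reserved Notation "a '⊑' b" (at level 70, no associativity).

Section SumOfStrategies.
Variable K : comPzSemiRingType.
Hypotheses (Kabs : absorptive K) (Kcont : fully_continuous K).

Local Notation "a '⊑' b" := (nle a b).

(** * The natural order of an absorptive semiring *)

Section Algebra.
Implicit Types a b c d x y z : K.

Lemma absorptive_idem a : a + a = a.
Proof. by rewrite -{2}(mulr1 a) Kabs. Qed.

Lemma nleE a b : (a ⊑ b) <-> a + b = b.
Proof.
split=> [[c <-]|ab]; last by exists b.
by rewrite addrA absorptive_idem.
Qed.

Lemma nle_refl a : a ⊑ a.
Proof. by apply/nleE; rewrite absorptive_idem. Qed.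

Lemma nle_trans b a c : a ⊑ b -> b ⊑ c -> a ⊑ c.
Proof. by move=> [x <-] [y <-]; exists (x + y); rewrite addrA. Qed.

Lemma nle_anti a b : a ⊑ b -> b ⊑ a -> a = b.
Proof. by move=> /nleE ab /nleE ba; rewrite -ab addrC -{1}ba. Qed.

Lemma nle0 a : 0 ⊑ a.
Proof. by exists a; rewrite add0r. Qed.

Lemma nle1 a : a ⊑ 1.
Proof. by apply/nleE; rewrite addrC -[X in _ + X = _](mul1r a) Kabs. Qed.

Lemma nle_addl a b : a ⊑ a + b.
Proof. by exists b. Qed.

Lemma nle_addr a b : b ⊑ a + b.
Proof. by exists a; rewrite addrC. Qed.

Lemma nle_lub a b c : a ⊑ c -> b ⊑ c -> a + b ⊑ c.
Proof. by move=> /nleE ac /nleE bc; apply/nleE; rewrite -addrA bc. Qed.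

Lemma nle_add a b c d : a ⊑ c -> b ⊑ d -> a + b ⊑ c + d.
Proof. by move=> [x <-] [y <-]; exists (x + y); rewrite addrACA. Qed.

Lemma nle_mul a b c d : a ⊑ c -> b ⊑ d -> a * b ⊑ c * d.
Proof.
move=> [x <-] [y <-]; exists (a * y + x * (b + y)).
by rewrite addrA mulrDl !mulrDr !addrA.
Qed.

Lemma nle_mull a b : a * b ⊑ b.
Proof. by rewrite -[X in _ ⊑ X]mul1r; apply: nle_mul (nle1 _) (nle_refl _). Qed.

Lemma nle_mulr a b : a * b ⊑ a.
Proof. by rewrite mulrC; apply: nle_mull. Qed.

Lemma nle_pow a m n : (m <= n)%N -> a ^+ n ⊑ a ^+ m.
Proof. by move=> /subnK <-; rewrite exprD; apply: nle_mull. Qed.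

Lemma nle_sum (I : Type) (s : seq I) (P : pred I) (F G : I -> K) :
  (forall i, P i -> F i ⊑ G i) ->
  \sum_(i <- s | P i) F i ⊑ \sum_(i <- s | P i) G i.
Proof.
by move=> FG; apply: big_ind2 => //; [apply: nle_refl|move=> *; apply: nle_add].
Qed.

Lemma nle_prod (I : Type) (s : seq I) (P : pred I) (F G : I -> K) :
  (forall i, P i -> F i ⊑ G i) ->
  \prod_(i <- s | P i) F i ⊑ \prod_(i <- s | P i) G i.
Proof.
by move=> FG; apply: big_ind2 => //; [apply: nle_refl|move=> *; apply: nle_mul].
Qed.

Lemma nle_sum_lub (I : Type) (s : seq I) (P : pred I) (F : I -> K) z :
  (forall i, P i -> F i ⊑ z) -> \sum_(i <- s | P i) F i ⊑ z.
Proof.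
by move=> Fz; elim/big_ind: _ => //; [apply: nle0|move=> *; apply: nle_lub].
Qed.

Lemma nle_sum_mem (I : eqType) (s : seq I) (F : I -> K) i :
  i \in s -> F i ⊑ \sum_(j <- s) F j.
Proof.
elim: s => // j s IH; rewrite inE big_cons => /predU1P[->|/IH is_].
  exact: nle_addl.
exact: nle_trans is_ (nle_addr _ _).
Qed.

(** All elements are below [1], so the factors of [t] outside [s] can only make the product
    smaller. *)
Lemma nle_prod_uniq_sub (I : eqType) (s t : seq I) (F : I -> K) :
  uniq s -> {subset s <= t} -> \prod_(i <- t) F i ⊑ \prod_(i <- s) F i.
Proof.
elim: s t => [|i s IH] t; first by rewrite big_nil => _ _; apply: nle1.
rewrite cons_uniq => /andP[is_ us] st.
have it : i \in t by apply: st; rewrite mem_head.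
rewrite (perm_big _ (perm_to_rem it)) !big_cons; apply: nle_mul (nle_refl _) _.
apply: IH => // j js; move: (st j); rewrite inE js orbT => /(_ isT).
rewrite (perm_mem (perm_to_rem it)) inE => /predU1P[ji|//].
by rewrite -ji js in is_.
Qed.

(* Every monomial [a^i b^j] with [i + j = 2n] is absorbed by [a^n] or by [b^n]. *)
Lemma nle_exp_add a b n : (a + b) ^+ (n + n) ⊑ a ^+ n + b ^+ n.
Proof.
rewrite exprDn; apply: nle_sum_lub => i _.
have -> (x : K) (m : nat) : (0 < m)%N -> x *+ m = x.
  by case: m => // m _; elim: m => // m IH; rewrite mulrS IH absorptive_idem.
- have [ni|ni] := leqP n i.
    apply: nle_trans (nle_addr _ _); apply: nle_trans (nle_mull _ _) _.
    exact: nle_pow.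
  apply: nle_trans (nle_addl _ _); apply: nle_trans (nle_mulr _ _) _.
  by apply: nle_pow; rewrite -addnBA ?leq_addr // ltnW.
- by rewrite bin_gt0 -ltnS.
Qed.

(* [+] is the binary join, so a maximal lower bound of the upper bounds of [S]
   is the greatest one. *)
Lemma sup_exists (S : set K) : exists s, is_sup S s.
Proof.
case: Kcont => Ksup _ _ _.
pose L := [set x : K | forall u, (forall y, S y -> y ⊑ u) -> x ⊑ u].
pose T := {x : K | L x}.
have L0 : L 0 by move=> u _; apply: nle0.
pose R (x y : T) := `[< sval x ⊑ sval y >].
have [||||m mmax] := @Zorn T R.
- by move=> x; apply/asboolP; apply: nle_refl.
- by move=> x y z /asboolP xy /asboolP yz; apply/asboolP; apply: nle_trans yz.
- move=> [x Lx] [y Ly] /asboolP xy /asboolP yx; apply: eq_exist.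
  exact: nle_anti xy yx.
- move=> C Ctot; have [|s [sub slub]] := Ksup [set sval x | x in C].
    by move=> _ _ [x Cx <-] [y Cy <-]; case: (Ctot x y Cx Cy) => /asboolP; [left|right].
  have Ls : L s.
    by move=> u Su; apply: slub => _ [x Cx <-]; apply: (svalP x).
  by exists (exist _ s Ls) => x Cx; apply/asboolP; apply: sub; exists x.
exists (sval m); split; last by move=> u; apply: (svalP m).
move=> x Sx; have Lmx : L (sval m + x).
  by move=> u Su; apply: nle_lub => //; [apply: (svalP m)|apply: Su].
have := mmax (exist _ _ Lmx); rewrite /R /= => /(_ _)/(congr1 sval) /= <-.
  exact: nle_addr.
by apply/asboolP; apply: nle_addl.
Qed.

Lemma inf_exists (S : set K) : exists s, is_inf S s.
Proof.
have [s [sub slub]] := sup_exists [set y | forall x, S x -> y ⊑ x].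
exists s; split=> [x Sx|u Su]; last exact: sub.
by apply: slub => y; apply.
Qed.

(** * Least and greatest fixed points of monotone operators *)

Section KnasterTarski.
Variables (I : finType) (F : {ffun I -> K} -> {ffun I -> K}).
Hypothesis Fmono : forall g h, fle g h -> fle (F g) (F h).
Implicit Types g h : {ffun I -> K}.

Lemma fle_anti g h : fle g h -> fle h g -> g = h.
Proof. by move=> gh hg; apply/ffunP => i; apply: nle_anti. Qed.

(** Knaster-Tarski: the pointwise infimum of all prefixed points is the least fixed point. Its
    existence shows that [lfp F] is not the default value of [xget]. *)
Lemma lfpP : F (lfp F) = lfp F /\ forall h, fle (F h) h -> fle (lfp F) h.
Proof.
have ex i : exists s, is_inf [set h i | h in [set h | fle (F h) h]] s.
  exact: inf_exists.
have [m mP] := choice ex.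
pose g := [ffun i => m i].
have gle h : fle (F h) h -> fle g h.
  by move=> Fh i; rewrite ffunE; apply: (mP i).1; exists h.
have gpre : fle (F g) g.
  move=> i; rewrite [g i]ffunE; apply: (mP i).2 => _ [h Fh <-].
  by apply: nle_trans (Fh i); apply: Fmono; apply: gle.
have gfix : F g = g by apply: fle_anti => //; apply: gle; apply: Fmono.
suff -> : lfp F = g by [].
have glfp : is_lfp F g.
  by split=> // h Fh; apply: gle => i; rewrite Fh; apply: nle_refl.
have [fix1 le1] := xgetPex [ffun=> 0] (ex_intro (is_lfp F) g glfp).
by apply: fle_anti; [apply: le1|apply: glfp.2].
Qed.

Lemma gfpP : F (gfp F) = gfp F /\ forall h, fle h (F h) -> fle h (gfp F).
Proof.
have ex i : exists s, is_sup [set h i | h in [set h | fle h (F h)]] s.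
  exact: sup_exists.
have [m mP] := choice ex.
pose g := [ffun i => m i].
have gge h : fle h (F h) -> fle h g.
  by move=> Fh i; rewrite ffunE; apply: (mP i).1; exists h.
have gpost : fle g (F g).
  move=> i; rewrite [g i]ffunE; apply: (mP i).2 => _ [h Fh <-].
  by apply: nle_trans (Fh i) _; apply: Fmono; apply: gge.
have gfix : F g = g by apply: fle_anti => //; apply: gge; apply: Fmono.
suff -> : gfp F = g by [].
have ggfp : is_gfp F g.
  by split=> // h Fh; apply: gge => i; rewrite Fh; apply: nle_refl.
have [fix1 ge1] := xgetPex [ffun=> 0] (ex_intro (is_gfp F) g ggfp).
by apply: fle_anti; [apply: ggfp.2|apply: ge1].
Qed.

End KnasterTarski.

Lemma lfp_mono (I : finType) (F G : {ffun I -> K} -> {ffun I -> K}) :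
  (forall g h, fle g h -> fle (F g) (F h)) ->
  (forall g h, fle g h -> fle (G g) (G h)) ->
  (forall g, fle (F g) (G g)) -> fle (lfp F) (lfp G).
Proof.
move=> Fm Gm FG; apply: (lfpP Fm).2 => i.
by have := FG (lfp G) i; rewrite (lfpP Gm).1.
Qed.

Lemma gfp_mono (I : finType) (F G : {ffun I -> K} -> {ffun I -> K}) :
  (forall g h, fle g h -> fle (F g) (F h)) ->
  (forall g h, fle g h -> fle (G g) (G h)) ->
  (forall g, fle (F g) (G g)) -> fle (gfp F) (gfp G).
Proof.
move=> Fm Gm FG; apply: (gfpP Gm).2 => i.
by have := FG (gfp F) i; rewrite (gfpP Fm).1.
Qed.

(** * Infima of decreasing sequences and infinite powers *)

Definition decreasing_to (u : nat -> K) a :=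
  (forall m n, (m <= n)%N -> u n ⊑ u m) /\ is_inf (range u) a.

Lemma decreasing_to_le u a n : decreasing_to u a -> a ⊑ u n.
Proof. by move=> [_ [+ _]]; apply; exists n. Qed.

Lemma decreasing_chain (u : nat -> K) :
  (forall m n, (m <= n)%N -> u n ⊑ u m) -> chain (range u).
Proof.
move=> ud _ _ [m _ <-] [n _ <-].
by case/orP: (leq_total m n) => /ud; [right|left].
Qed.

(** Continuity in each argument in turn gives the infimum of all [op (u n) (v m)]. The diagonal has
    the same infimum: its term at [maxn m n] is below [op (u n) (v m)], as both sequences
    decrease. *)
Lemma decreasing_to_op (op : K -> K -> K) u v a b :
  commutative op ->
  (forall x y z t, x ⊑ z -> y ⊑ t -> op x y ⊑ op z t) ->
  (forall (C : set K) x s, chain C -> C !=set0 -> is_inf C s ->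
     is_inf [set op x y | y in C] (op x s)) ->
  decreasing_to u a -> decreasing_to v b ->
  decreasing_to (fun n => op (u n) (v n)) (op a b).
Proof.
move=> opC opm opinf ua vb; split.
  by move=> m n mn; apply: opm; [apply: ua.1|apply: vb.1].
split=> [_ [n _ <-]|z zle]; first by apply: opm; apply: decreasing_to_le.
apply: (opinf _ a b (decreasing_chain vb.1) _ vb.2).2; first by exists (v 0%N); exists 0%N.
move=> _ [_ [m _ <-] <-]; rewrite opC.
apply: (opinf _ (v m) a (decreasing_chain ua.1) _ ua.2).2; first by exists (u 0%N); exists 0%N.
move=> _ [_ [n _ <-] <-]; rewrite opC.
apply: nle_trans (zle _ (ex_intro2 _ _ (maxn m n) I erefl)) _.
by apply: opm; [apply: ua.1; apply: leq_maxr|apply: vb.1; apply: leq_maxl].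
Qed.

Lemma decreasing_to_add u v a b : decreasing_to u a -> decreasing_to v b ->
  decreasing_to (fun n => u n + v n) (a + b).
Proof.
case: Kcont => _ _ _ Kinf; apply: decreasing_to_op; first exact: addrC.
  by move=> *; apply: nle_add.
by move=> C x s cC C0 Cs; apply: (Kinf C x s cC C0 Cs).1.
Qed.

Lemma decreasing_to_mul u v a b : decreasing_to u a -> decreasing_to v b ->
  decreasing_to (fun n => u n * v n) (a * b).
Proof.
case: Kcont => _ _ _ Kinf; apply: decreasing_to_op; first exact: mulrC.
  by move=> *; apply: nle_mul.
by move=> C x s cC C0 Cs; apply: (Kinf C x s cC C0 Cs).2.
Qed.

Lemma decreasing_to_const a : decreasing_to (fun=> a) a.
Proof.
split=> [*|]; first exact: nle_refl.
by split=> [_ [_ _ <-]|u]; [apply: nle_refl|apply; exists 0%N].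
Qed.

Lemma decreasing_to_ge u a z : decreasing_to u a -> (forall n, z ⊑ u n) -> z ⊑ a.
Proof. by move=> [_ [_ uinf]] zu; apply: uinf => _ [n _ <-]. Qed.

Lemma infpowP a : decreasing_to (fun n => a ^+ n) (infpow a).
Proof.
split; first by move=> m n; apply: nle_pow.
exact: (xgetPex 0 (inf_exists (range (fun n => a ^+ n)))).
Qed.

Lemma infpow_le a n : infpow a ⊑ a ^+ n.
Proof. exact: (decreasing_to_le n (infpowP a)). Qed.

Lemma infpow_ge a z : (forall n, z ⊑ a ^+ n) -> z ⊑ infpow a.
Proof. exact: decreasing_to_ge (infpowP a). Qed.

(** The left side is below the power with exponent [n + n], hence below [a ^+ n + b ^+ n]; addition
    preserves the infimum over [n]. *)
Lemma infpow_add a b : infpow (a + b) ⊑ infpow a + infpow b.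
Proof.
apply: decreasing_to_ge (decreasing_to_add (infpowP a) (infpowP b)) _ => n.
by apply: nle_trans (nle_exp_add a b n); apply: infpow_le.
Qed.

Lemma infpow_sum (I : Type) (s : seq I) (F : I -> K) :
  infpow (\sum_(i <- s) F i) ⊑ \sum_(i <- s) infpow (F i).
Proof.
elim: s => [|i s IH].
  by rewrite !big_nil; have := infpow_le 0 1; rewrite expr1.
rewrite !big_cons; apply: nle_trans (infpow_add _ _) _.
by apply: nle_add => //; apply: nle_refl.
Qed.

Lemma infpow1 : infpow (1 : K) = 1.
Proof.
apply: nle_anti; first exact: nle1.
by apply: infpow_ge => n; rewrite expr1n; apply: nle_refl.
Qed.

(** Multiplication by [a ^+ n] preserves the infimum of the powers [a ^+ m], and every
    [a ^+ (m + n)] is above [infpow a]. *)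
Lemma infpowMr a n : infpow a = infpow a * a ^+ n.
Proof.
apply: nle_anti; last exact: nle_mulr.
apply: decreasing_to_ge (decreasing_to_mul (infpowP a) (decreasing_to_const _)) _.
by move=> m; rewrite -exprD; apply: infpow_le.
Qed.

Lemma infpowMinf a : infpow a = infpow a * infpow a.
Proof.
apply: nle_anti; last exact: nle_mulr.
apply: decreasing_to_ge (decreasing_to_mul (infpowP a) (infpowP a)) _.
by move=> m; rewrite -exprD; apply: infpow_le.
Qed.

Lemma epow1 k : epow (1 : K) k = 1.
Proof. by case: k => [n|] /=; rewrite ?expr1n ?infpow1. Qed.

(** Truncation of an exponent at [N]. It presents finite and infinite powers alike as infima of
    finite powers, with one [N] for a whole product. *)
Definition ominn (k : option nat) N := if k is Some n then minn n N else N.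

Lemma epowP a k : decreasing_to (fun N => a ^+ ominn k N) (epow a k).
Proof.
case: k => [n|] /=; last exact: infpowP.
split=> [i j ij|]; first by apply: nle_pow; rewrite leq_min geq_minl geq_min ij orbT.
split=> [_ [N _ <-]|u]; first by apply: nle_pow; rewrite geq_minl.
by apply; exists n => //; rewrite minnn.
Qed.

Lemma epow_prodP (I : Type) (s : seq I) (w : I -> K) (k : I -> option nat) :
  decreasing_to (fun N => \prod_(i <- s) w i ^+ ominn (k i) N)
    (\prod_(i <- s) epow (w i) (k i)).
Proof.
elim: s => [|i s IH].
  by rewrite big_nil; under [X in decreasing_to X]eq_fun do rewrite big_nil;
  apply: decreasing_to_const.
rewrite big_cons; under [X in decreasing_to X]eq_fun do rewrite big_cons.
exact: decreasing_to_mul (epowP _ _) IH.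
Qed.

(* Iterating [x <= b + c x] gives [x <= b + c^n] for all [n]. *)
Lemma postfix_affine b c x : x ⊑ b + c * x -> x ⊑ b + infpow c.
Proof.
move=> xle; have := decreasing_to_add (decreasing_to_const b) (infpowP c).
move/decreasing_to_ge; apply; elim=> [|n IH].
  by rewrite expr0; apply: nle_trans (nle_addr _ _); apply: nle1.
apply: nle_trans xle _; apply: nle_lub; first exact: nle_addl.
apply: nle_trans (nle_mul (nle_refl c) IH) _.
rewrite mulrDr -exprS; apply: nle_add; first exact: nle_mull.
exact: nle_refl.
Qed.

(** * Finite products, distributivity and cardinalities in N + {oo} *)

(** Distributivity, with [cs] listing the choice functions. The list is fixed before the values [v],
    which later keeps finite lists of trees independent of the values of the exits. Outside [qs] the
    functions take the arbitrary value [x0]. *)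
Lemma prod_sum_seq (I T : eqType) (x0 : T) (qs : seq I) (M : I -> seq T) :
  uniq qs -> exists cs : seq (I -> T),
    (forall f, f \in cs -> forall q, q \in qs -> f q \in M q) /\
    forall v : I -> T -> K, \prod_(q <- qs) \sum_(t <- M q) v q t =
      \sum_(f <- cs) \prod_(q <- qs) v q (f q).
Proof.
elim: qs => [|q qs IH].
  move=> _; exists [:: fun=> x0]; split=> // v.
  by rewrite big_seq1 !big_nil.
rewrite cons_uniq => /andP[qqs /IH[cs [csM csE]]].
pose upd t (f : I -> T) := fun p => if p == q then t else f p.
exists [seq upd t f | t <- M q, f <- cs]; split.
  move=> _ /allpairsP[[t f] /= [tM fcs ->]] p; rewrite inE /upd.
  by case: eqVneq => [-> //|_] /= pqs; apply: csM.
move=> v; rewrite big_cons csE big_allpairs_dep mulr_suml; apply: eq_bigr => t _.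
rewrite mulr_sumr; apply: eq_bigr => f _.
rewrite big_cons {1}/upd eqxx; congr (_ * _); apply: eq_big_seq => p pqs.
by rewrite /upd; case: eqVneq pqs qqs => // -> ->.
Qed.

Lemma prod_group (I J : eqType) (s : seq I) (t : seq J) (k : I -> J) (F : I -> K) :
  uniq t -> (forall i, i \in s -> k i \in t) ->
  \prod_(i <- s) F i = \prod_(j <- t) \prod_(i <- s | k i == j) F i.
Proof.
move=> ut st; rewrite (exchange_big_dep xpredT) //=.
apply: eq_big_seq => i /st kit.
rewrite big_mkcond /= (bigD1_seq (k i)) //= eqxx big1 ?mulr1 // => j.
by rewrite eq_sym => /negbTE ->.
Qed.

Lemma prod_const_mem (I : eqType) (s : seq I) (F : I -> K) a :
  (forall i, i \in s -> F i = a) -> \prod_(i <- s) F i = a ^+ size s.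
Proof.
move=> Fa; rewrite (eq_big_seq (fun=> a)) // big_const_seq count_predT.
exact: iter_mulr_1.
Qed.

(** Written with the body of [nplays], so that the two are convertible on sets of plays. *)
Definition ecard (T : choiceType) (A : set T) : option nat :=
  if `[< finite_set A >] then Some #|` fset_set A| else None.

Lemma ecard_lower (T : choiceType) (A : set T) N :
  exists s : seq T, [/\ uniq s, forall h, h \in s -> A h & size s = ominn (ecard A) N].
Proof.
rewrite /ecard; case: asboolP => [fA|iA] /=.
  exists (take N (fset_set A)); split.
  - by apply: take_uniq; apply: fset_uniq.
  - by move=> h /mem_take; rewrite in_fset_set // inE.
  - by rewrite size_take_min minnC.
have [B BA NB] := infinite_set_fset N iA.
exists (take N B); split; first by apply: take_uniq; apply: fset_uniq.
  by move=> h /mem_take; apply: BA.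
by rewrite size_take_min; apply/minn_idPl.
Qed.

Lemma epow_ecard_le (T : choiceType) (A : set T) (s : seq T) a :
  uniq s -> (forall h, h \in s -> A h) -> epow a (ecard A) ⊑ a ^+ size s.
Proof.
move=> us sA; rewrite /ecard; case: asboolP => [fA|_] /=; last exact: infpow_le.
apply: nle_pow; apply: uniq_leq_size => // h /sA Ah.
by rewrite in_fset_set // inE.
Qed.

(** * Values of sets of weighted histories *)

Section WeightedSets.
Variables (T : choiceType) (Lb : eqType) (ls : seq Lb) (lab : T -> Lb).
Hypothesis ls_uniq : uniq ls.
Implicit Types (w : Lb -> K) (A B : set T) (hs : seq T).

(** The product of the weights of all elements of the possibly infinite set [A]. Grouping by label
    leaves finitely many factors, each a finite or infinite power. *)
Definition pval w A : K :=
  \prod_(x <- ls) epow (w x) (ecard (A `&` [set h | lab h = x])).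

(** With [pval_le], this makes [pval w A] the infimum of the products over the finite subsets of
    [A]. Most comparisons of values below are reduced in this way to finite products. Truncating all
    exponents at [N] yields a product over one finite list. *)
Lemma pval_ge w A z :
  (forall hs, uniq hs -> (forall h, h \in hs -> A h) ->
     z ⊑ \prod_(h <- hs) w (lab h)) -> z ⊑ pval w A.
Proof.
move=> zle; apply: decreasing_to_ge (epow_prodP _ _ _) _ => N.
have [hs [uhs hsA _ <-]] : exists hs, [/\ uniq hs, forall h, h \in hs -> A h,
    forall h, h \in hs -> lab h \in ls &
    \prod_(h <- hs) w (lab h) = \prod_(x <- ls)
       w x ^+ ominn (ecard (A `&` [set h | lab h = x])) N].
  elim: (ls) (ls_uniq) => [|x l IH]; first by exists [::]; rewrite !big_nil.
  rewrite cons_uniq => /andP[xl /IH[hs [uhs hsA hsl hsE]]].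
  have [s [us sA ss]] := ecard_lower (A `&` [set h | lab h = x]) N.
  exists (s ++ hs); split.
  - rewrite cat_uniq us uhs andbT /=; apply/hasPn => h /hsl hl.
    by apply/negP => /sA [_ /= hx]; rewrite hx (negbTE xl) in hl.
  - by move=> h; rewrite mem_cat => /orP[/sA[]|/hsA].
  - move=> h; rewrite mem_cat inE => /orP[/sA[_ ->]|/hsl ->]; last by rewrite orbT.
    by rewrite eqxx.
  - rewrite big_cat big_cons hsE; congr (_ * _).
    by rewrite -ss; apply: prod_const_mem => h /sA[_ ->].
exact: zle.
Qed.

Hypothesis lab_ls : forall h, lab h \in ls.

Lemma pval_le w A hs : uniq hs -> (forall h, h \in hs -> A h) ->
  pval w A ⊑ \prod_(h <- hs) w (lab h).
Proof.
move=> uhs hsA; rewrite (prod_group (k := lab) _ ls_uniq) //.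
apply: nle_prod => x _; rewrite -big_filter.
have -> : \prod_(h <- [seq h <- hs | lab h == x]) w (lab h) =
    w x ^+ size [seq h <- hs | lab h == x].
  by apply: prod_const_mem => h; rewrite mem_filter => /andP[/eqP ->].
apply: epow_ecard_le; first exact: filter_uniq.
by move=> h; rewrite mem_filter => /andP[/eqP hx /hsA].
Qed.

Lemma pval_anti w A B : B `<=` A -> pval w A ⊑ pval w B.
Proof.
move=> BA; apply: pval_ge => hs uhs hsB; apply: pval_le => // h /hsB.
exact: BA.
Qed.

(** For two finite sets the exponents add up. If one of them is infinite, its infinite power absorbs
    the other factor. *)
Lemma epow_setU a (A B : set T) : (forall h, A h -> B h -> False) ->
  epow a (ecard (A `|` B)) ⊑ epow a (ecard A) * epow a (ecard B).
Proof.
move=> AB; rewrite /ecard; case: asboolP => [fAB|iAB].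
  move: (fAB); rewrite finite_setU => -[fA fB].
  rewrite !asboolT //= -exprD fset_setU // cardfsU.
  suff -> : (fset_set A `&` fset_set B = fset0)%fset.
    by rewrite cardfs0 subn0; apply: nle_refl.
  apply/fsetP => h; rewrite !inE !in_fset_set //; apply/negbTE/negP.
  by move=> /andP[/set_mem Ah /set_mem]; apply: AB.
case: asboolP => fA /=; case: asboolP => fB /=.
- by case: iAB; rewrite finite_setU.
- by rewrite mulrC -infpowMr; apply: nle_refl.
- by rewrite -infpowMr; apply: nle_refl.
- by rewrite -infpowMinf; apply: nle_refl.
Qed.

Lemma pval_setU w A B : (forall h, A h -> B h -> False) ->
  pval w (A `|` B) ⊑ pval w A * pval w B.
Proof.
move=> AB; rewrite /pval -big_split; apply: nle_prod => x _ /=.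
rewrite setIUl; apply: epow_setU => h [Ah _] [Bh _]; exact: AB Ah Bh.
Qed.

(** The sets [B i] need not cover [A]: the factors they miss are below [1]. *)
Lemma pval_disjoint w A (I : eqType) (s : seq I) (B : I -> set T) :
  uniq s -> (forall i, i \in s -> B i `<=` A) ->
  (forall i j h, i \in s -> j \in s -> B i h -> B j h -> i = j) ->
  pval w A ⊑ \prod_(i <- s) pval w (B i).
Proof.
elim: s A => [|i s IH] A; first by rewrite big_nil => *; apply: nle1.
rewrite cons_uniq => /andP[is_ us] BA Bdis; rewrite big_cons.
pose C := [set h | exists2 j, j \in s & B j h].
have CA : B i `|` C `<=` A.
  move=> h [Bh|[j js Bh]]; first by apply: BA Bh; rewrite mem_head.
  by apply: BA Bh; rewrite inE js orbT.
apply: nle_trans (pval_anti w CA) _.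
apply: nle_trans (pval_setU w _) _.
  move=> h Bh [j js Bjh]; move: is_.
  by rewrite (Bdis i j h) ?js // inE ?eqxx ?js ?orbT.
apply: nle_mul (nle_refl _) (IH _ us _ _).
  by move=> j js h Bh; exists j.
by move=> j k h js ks; apply: Bdis; rewrite inE ?js ?ks orbT.
Qed.

Lemma pval_set1 w h : pval w [set h] ⊑ w (lab h).
Proof.
have := @pval_le w [set h] [:: h].
by rewrite big_seq1; apply=> // k; rewrite inE => /eqP ->.
Qed.

End WeightedSets.

End Algebra.

(** * Strategy trees *)

Section Trees.
Variables (L : choiceType) (P : finType) (nd : P -> node L P) (pi : L -> K).
Implicit Types (p q y : P) (h u : seq P) (H : set (seq P)) (E Y : {set P})
  (eps : P -> K) (f : nat -> P).

Definition step p q := q \in succs (nd p).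
Definition verif p := verifier_node (nd p).
Definition terminal p := if nd p is Terminal _ then true else false.

(** The root does not count as a visit: the empty history is never stopped. A play can thus start at
    an exit, which is what happens at the body of a fixed-point operator. *)
Definition stopped E h : bool := if h is q :: h' then last q h' \in E else false.

(* [tree p E H]: [H] consists of the histories, without their root [p], that are
   consistent with some Verifier strategy from [p] when the play stops as soon
   as a position of [E] is reached after at least one move. *)
Record tree p E H : Prop := Tree {
  tree_nil : H [::];
  tree_rcons : forall h q, H (rcons h q) ->
    [/\ H h, ~~ stopped E h & step (last p h) q];
  tree_verif : forall h, H h -> ~~ stopped E h -> verif (last p h) ->
    exists q, H (rcons h q);
  tree_verif_uniq : forall h q q', verif (last p h) ->
    H (rcons h q) -> H (rcons h q') -> q = q';
  tree_falsif : forall h q, H h -> ~~ stopped E h -> ~~ verif (last p h) ->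
    step (last p h) q -> H (rcons h q)
}.

Definition branch p H f := f 0%N = p /\ forall n, H (mkseq (fun i => f i.+1) n).

Definition recurs f (c : nat) :=
  forall n, exists2 k, (n <= k)%N & priority (nd (f k)) = Some c.

Definition won f := exists c : nat, [/\ ~~ odd c, recurs f c &
  forall c' : nat, (c' < c)%N -> ~ recurs f c'].

Definition wtree p E H := tree p E H /\ forall f, branch p H f -> won f.

Lemma stopped_rcons E h q : stopped E (rcons h q) = (q \in E).
Proof. by case: h => //= x h; rewrite last_rcons. Qed.

Lemma stopped_cat E u h : ~~ stopped E u -> stopped E (u ++ h) = stopped E h.
Proof.
case/lastP: h => [|h q]; first by rewrite cats0 => /negbTE.
by rewrite -rcons_cat !stopped_rcons.
Qed.

Lemma stopped_last E p h : stopped E h -> last p h \in E.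
Proof. by case: h. Qed.

Lemma stoppedU E Y h : stopped (Y :|: E) h = stopped Y h || stopped E h.
Proof. by case: h => //= q h; rewrite finset.in_setU. Qed.

Lemma recurs_shift f k c : recurs (fun n => f (k + n)%N) c <-> recurs f c.
Proof.
split=> rec n.
  have [m nm fm] := rec n; exists (k + m)%N => //.
  by rewrite (leq_trans nm) // leq_addl.
have [m nm fm] := rec (k + n)%N; exists (m - k)%N.
  by rewrite leq_subRL // (leq_trans _ nm) // leq_addr.
by rewrite subnKC // (leq_trans _ nm) // leq_addr.
Qed.

Lemma won_shift f k : won (fun n => f (k + n)%N) <-> won f.
Proof.
rewrite /won; split=> -[c [oc rc minc]]; exists c; split=> //.
- exact/(recurs_shift f k).
- by move=> c' c'c /(recurs_shift f k); apply: minc.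
- exact/(recurs_shift f k).
- by move=> c' c'c /(recurs_shift f k); apply: minc.
Qed.

Lemma tree_prefix p E H u h : tree p E H -> H (u ++ h) -> H u.
Proof.
move=> tH; elim/last_ind: h => [|h q IH]; first by rewrite cats0.
by rewrite -rcons_cat => /(tree_rcons tH)[/IH].
Qed.

Definition sub u H : set (seq P) := [set h | H (u ++ h)].

Lemma mkseqD (T : Type) (g : nat -> T) m n :
  mkseq g (m + n) = mkseq g m ++ mkseq (fun i => g (m + i)%N) n.
Proof.
by rewrite /mkseq iotaD map_cat add0n -[X in iota X n]addn0 iotaDl -map_comp.
Qed.

Lemma branch_sub p E H u f : tree p E H -> branch (last p u) (sub u H) f ->
  exists2 f', branch p H f' & forall n, f' (size u + n)%N = f n.
Proof.
move=> tH [f0 fH].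
(* Follow [p :: u] and then [f]. The position [last p u = f 0] is shared by both parts and has index
   [size u]. *)
pose f' n := if (n < size u)%N then nth p (p :: u) n else f (n - size u)%N.
have f'_shift n : f' (size u + n)%N = f n by rewrite /f' ltnNge leq_addr addKn.
exists f' => //; split.
  by rewrite /f'; case: u f0 {fH f' f'_shift}.
have f'u : mkseq (fun i => f' i.+1) (size u) = u.
  apply: (@eq_from_nth _ p); rewrite size_mkseq // => i iu.
  rewrite nth_mkseq // /f'; case: ltnP => // ui.
  have -> : i.+1 = size u by apply/eqP; rewrite eqn_leq iu ui.
  rewrite subnn f0 (last_nth p) -[nth p u i]/(nth p (p :: u) i.+1).
  by congr nth; apply/eqP; rewrite eqn_leq ui iu.
move=> n; apply: (@tree_prefix p E H _ (mkseq (fun i => f' (n + i).+1) (size u))) => //.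
rewrite -mkseqD addnC mkseqD f'u.
have -> : mkseq (fun i => f' (size u + i).+1) n = mkseq (fun i => f i.+1) n.
  by apply: eq_map => i; rewrite -addnS f'_shift.
exact: fH.
Qed.

Lemma wtree_sub p E H u : wtree p E H -> H u -> ~~ stopped E u ->
  wtree (last p u) E (sub u H).
Proof.
move=> [tH wH] Hu uE; split.
  split=> [|h q|h|h q q'|h q]; rewrite /sub /= ?cats0 -?rcons_cat -?last_cat //.
  - by move=> /(tree_rcons tH)[]; rewrite (stopped_cat _ uE).
  - rewrite -(stopped_cat h uE) => Hh hE vh.
    by have [q Hq] := tree_verif tH Hh hE vh; exists q; rewrite -rcons_cat.
  - exact: (tree_verif_uniq tH).
  - by rewrite -(stopped_cat h uE); apply: (tree_falsif tH).
move=> f /(branch_sub tH)[f' /wH wf' ff']; move/(won_shift f' (size u)): wf'.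
by rewrite (_ : (fun n => f' _) = f) //; apply/funext.
Qed.

(** * Leaves of a tree and its value *)

Definition leaf p E H : set (seq P) :=
  [set h | H h /\ (stopped E h || terminal (last p h))].

(* The same position can be an exit and, as the root of another play, terminal:
   the label records whether the play was stopped. *)
Definition label p E h : bool * P := (stopped E h, last p h).

Definition weight eps (x : bool * P) : K :=
  if x.1 then eps x.2 else if nd x.2 is Terminal l then pi l else 1.

Definition val p E eps H : K :=
  pval (enum {: bool * P}) (label p E) (weight eps) (leaf p E H).

Definition valsum p E eps (Hs : seq (set (seq P))) : K :=
  \sum_(H <- Hs) val p E eps H.

Lemma val_ge p E eps H z :
  (forall hs, uniq hs -> (forall h, h \in hs -> leaf p E H h) ->
     z ⊑ \prod_(h <- hs) weight eps (label p E h)) -> z ⊑ val p E eps H.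
Proof. exact/pval_ge/enum_uniq. Qed.

Lemma val_le p E eps H hs : uniq hs -> (forall h, h \in hs -> leaf p E H h) ->
  val p E eps H ⊑ \prod_(h <- hs) weight eps (label p E h).
Proof. by apply: pval_le => [|h]; rewrite ?enum_uniq ?mem_enum. Qed.

Lemma label_cat p E u h : ~~ stopped E u ->
  label p E (u ++ h) = label (last p u) E h.
Proof. by move=> uE; rewrite /label stopped_cat // last_cat. Qed.

Lemma leaf_sub p E H u h : ~~ stopped E u ->
  leaf (last p u) E (sub u H) h = leaf p E H (u ++ h).
Proof. by move=> uE; rewrite /leaf /= last_cat stopped_cat. Qed.

(** Deleting the common prefix [u] turns a group of histories into distinct leaves of the tree [H].
    When a tree is assembled from others, its leaves are treated one such group at a time. *)
Lemma val_le_group p q E E' eps eps' H u hs : uniq hs ->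
  (forall h, h \in hs -> exists h', [/\ h = u ++ h', leaf q E H h' &
     weight eps (label q E h') ⊑ weight eps' (label p E' h)]) ->
  val q E eps H ⊑ \prod_(h <- hs) weight eps' (label p E' h).
Proof.
move=> uhs hsu; pose d := drop (size u) : seq P -> seq P.
have dK h : h \in hs -> h = u ++ d h.
  by move=> /hsu[h' [-> _ _]]; rewrite /d drop_size_cat.
have := @val_le q E eps H (map d hs); rewrite big_map.
move=> /(_ _ _)/nle_trans; apply.
- rewrite map_inj_in_uniq // => h k /dK eh /dK ek ehk.
  by rewrite eh ek ehk.
- by move=> _ /mapP[h /hsu[h' [-> lh' _]] ->]; rewrite /d drop_size_cat.
rewrite !big_seq; apply: nle_prod => h /hsu[h' [hE _]].
by rewrite {2}hE /d drop_size_cat.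
Qed.

Lemma val_sub p E eps H u : ~~ stopped E u ->
  pval (enum {: bool * P}) (label p E) (weight eps)
    [set u ++ h | h in leaf (last p u) E (sub u H)] ⊑
  val (last p u) E eps (sub u H).
Proof.
move=> uE; apply: val_ge => hs uhs hsl.
have := @pval_le _ _ (enum {: bool * P}) (label p E) (enum_uniq _) _ (weight eps)
  [set u ++ h | h in leaf (last p u) E (sub u H)] (map (cat u) hs).
rewrite big_map; under eq_bigr do rewrite label_cat //; apply.
- by move=> h; rewrite mem_enum.
- by rewrite map_inj_uniq // => h k /eqP; rewrite eqseq_cat // eqxx => /eqP.
- by move=> _ /mapP[h /hsl lh ->]; exists h.
Qed.

(** * Trees and their children *)

Definition join (D : seq P) (c : P -> set (seq P)) : set (seq P) :=
  fun h => if h is q :: h' then q \in D /\ c q h' else True.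

Lemma stopped_cons E q h : q \notin E -> stopped E (q :: h) = stopped E h.
Proof. by move=> qE; rewrite -cat1s stopped_cat. Qed.

Lemma wtree_join p E D c :
  (forall q, q \in D -> wtree q E (c q)) ->
  (forall q, q \in D -> q \notin E) ->
  (if verif p then exists2 q, D = [:: q] & step p q
   else forall q, (q \in D) = step p q) ->
  wtree p E (join D c).
Proof.
move=> wc DE Dp; split.
  split=> //.
  - case=> [|x h] q /=; last first.
      case=> xD /(tree_rcons (wc x xD).1)[].
      by rewrite -[_ \in E]/(stopped E (x :: h)) stopped_cons ?DE.
    move=> [qD _]; split=> //; move: Dp; case: ifP => _; last by move <-.
    by case=> x Dx; move: qD; rewrite Dx inE => /eqP ->.
  - case=> [|x h] /=.
      move=> _ _ vp; move: Dp; rewrite vp => -[q Dq _].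
      have qD : q \in D by rewrite Dq mem_head.
      by exists q; split=> //; apply: tree_nil (wc q qD).1.
    move=> [xD ch]; rewrite -[_ \in E]/(stopped E (x :: h)) stopped_cons ?DE // => hE vh.
    by have [q cq] := tree_verif (wc x xD).1 ch hE vh; exists q.
  - case=> [|x h] q q' /= vh.
      move: Dp; rewrite vh => -[x -> _] [+ _] [+ _].
      by rewrite !inE => /eqP -> /eqP ->.
    by move=> [xD c1] [_ c2]; apply: (tree_verif_uniq (wc x xD).1 vh).
  - case=> [|x h] q /=.
      move=> _ _ /negbTE vp pq; move: Dp; rewrite vp => Dp.
      have qD : q \in D by rewrite Dp.
      by split=> //; apply: tree_nil (wc q qD).1.
    move=> [xD ch]; rewrite -[_ \in E]/(stopped E (x :: h)) stopped_cons ?DE // => *.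
    by split=> //; apply: (tree_falsif (wc x xD).1).
move=> f [_ fH]; apply/(won_shift f 1).
have [qD _] := fH 1%N; apply: (wc _ qD).2; split=> // n.
by have := fH (1 + n)%N; rewrite mkseqD => -[].
Qed.

(** A leaf of the joined tree lies below exactly one first move, the root not being terminal.
    Grouping finitely many leaves by this move gives one factor for each child. *)
Lemma val_join p E D c eps : ~~ terminal p -> uniq D ->
  (forall q, q \in D -> q \notin E) ->
  \prod_(q <- D) val q E eps (c q) ⊑ val p E eps (join D c).
Proof.
move=> tp uD DE; apply: val_ge => hs uhs hsl.
have hsD h : h \in hs -> exists q h', [/\ h = q :: h', q \in D & leaf q E (c q) h'].
  move=> /hsl; case: h => [|q h] [/=]; first by rewrite (negbTE tp).
  move=> [qD ch] lh; exists q, h; split=> //; split=> //.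
  by move: lh; rewrite -[_ \in E]/(stopped E (q :: h)) stopped_cons ?DE.
rewrite [X in _ ⊑ X](prod_group (k := head p) _ uD); last first.
  by move=> h /hsD[q [h' [-> qD _]]].
rewrite big_seq [X in _ ⊑ X]big_seq; apply: nle_prod => q qD.
rewrite -big_filter; apply: (val_le_group (u := [:: q])); first exact: filter_uniq.
move=> h; rewrite mem_filter => /andP[/eqP hq /hsD[x [h' [hE xD lh]]]].
move: hq; rewrite hE /= => xq; subst x; exists h'; split=> //.
by rewrite /label stopped_cons ?DE //; apply: nle_refl.
Qed.

Lemma val_children p E H D eps : wtree p E H -> uniq D ->
  (forall q, q \in D -> H [:: q]) -> (forall q, q \in D -> q \notin E) ->
  val p E eps H ⊑ \prod_(q <- D) val q E eps (sub [:: q] H).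
Proof.
move=> wH uD DH DE.
have := @pval_disjoint _ _ (enum {: bool * P}) (label p E) (enum_uniq _) _ (weight eps)
  (leaf p E H) P D (fun q => [set [:: q] ++ h | h in leaf q E (sub [:: q] H)]) uD.
move=> /(_ _ _ _)/nle_trans; apply.
- by move=> h; rewrite mem_enum.
- move=> q qD _ [h lh <-]; rewrite -leaf_sub //=; exact: DE.
- by move=> q q' h _ _ [h1 _ <-] [h2 _ [->]].
rewrite !big_seq; apply: nle_prod => q qD.
by have := @val_sub p E eps H [:: q]; apply; apply: DE.
Qed.

(** * Cutting a tree at its first visits to a set of positions *)

Definition cut Y H : set (seq P) := [set h | H h /\
  forall h' q, h = rcons h' q -> all (fun r => r \notin Y) h'].

Lemma wtree_cut p E Y H : wtree p E H -> wtree p (Y :|: E) (cut Y H).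
Proof.
move=> [tH wH]; split; last first.
  by move=> f [f0 fH]; apply: wH; split=> // n; have [] := fH n.
have cutr h q : cut Y H (rcons h q) <-> H (rcons h q) /\ all (fun r => r \notin Y) h.
  split=> [[Hq hY]|[Hq hY]]; first by split=> //; apply: hY erefl.
  by split=> // h' q' /rcons_inj[<- _].
have stopY h : all (fun r => r \notin Y) h -> stopped Y h = false.
  case: h => // q h /allP hY; apply/negbTE; apply: hY; exact: mem_last.
have cutY h : cut Y H h -> ~~ stopped Y h -> all (fun r => r \notin Y) h.
  case/lastP: h => // h q /cutr[_ hY]; rewrite stopped_rcons all_rcons => qY.
  by rewrite qY.
split.
- by split=> [|h q /(congr1 size)]; [apply: tree_nil tH|rewrite size_rcons].
- move=> h q /cutr[/(tree_rcons tH)[Hh hE hq] hY]; split=> //.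
    split=> // h' q' hE'; move: hY; rewrite hE' all_rcons => /andP[//].
  by rewrite stoppedU (stopY h hY).
- move=> h ch; rewrite stoppedU negb_or => /andP[hY hE] vh.
  have [q Hq] := tree_verif tH ch.1 hE vh; exists q; apply/cutr; split=> //.
  exact: cutY.
- by move=> h q q' vh /cutr[h1 _] /cutr[h2 _]; apply: (tree_verif_uniq tH) h1 h2.
- move=> h q ch; rewrite stoppedU negb_or => /andP[hY hE] vh hq.
  by apply/cutr; split; [apply: (tree_falsif tH) => //; apply: ch.1|apply: cutY].
Qed.

(** A leaf [h] of the cut tree that is stopped in [Y] stands for all leaves of [H] that extend it;
    these contribute the value of the residual tree, which the new exit value bounds. *)
Lemma val_cut p E Y eps eps' H :
  (forall q, q \in Y -> q \notin E) ->
  (forall q, q \in E -> eps q ⊑ eps' q) ->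
  (forall h, cut Y H h -> stopped Y h ->
     val (last p h) E eps (sub h H) ⊑ eps' (last p h)) ->
  val p E eps H ⊑ val p (Y :|: E) eps' (cut Y H).
Proof.
move=> YE ee' leY; apply: val_ge => hs uhs hsl.
(* [B h] collects the leaves of [H] represented by the leaf [h] of the cut tree. *)
pose B h := if stopped Y h then [set h ++ h' | h' in leaf (last p h) E (sub h H)]
            else [set h].
have BP h k : B h k -> exists2 t, k = h ++ t & stopped Y h \/ t = [::].
  rewrite /B; case: ifP => [_ [t _ <-]|_ ->]; first by exists t; last by left.
  by exists [::]; [rewrite cats0|right].
have nE h : stopped Y h -> ~~ stopped E h.
  by case: h => //= q h /YE.
have cut_pre h t : cut Y H (h ++ t) -> stopped Y h -> t = [::].
  case/lastP: t => // t q; rewrite -rcons_cat => -[_ /(_ _ _ erefl)].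
  rewrite all_cat => /andP[/allP hY _]; case: h hY => // r h hY /= rY.
  by have := hY _ (mem_last r h); rewrite rY.
(* Both [i] and [j] are prefixes of [k], so one is a prefix of the other; no leaf of the cut tree
   extends another one. *)
have Bdis i j k : i \in hs -> j \in hs -> B i k -> B j k -> i = j.
  move=> /hsl[ci _] /hsl[cj _] /BP[s -> si] /BP[t e tj].
  have [ij|ji] := leqP (size i) (size j).
    have jE : j = i ++ drop (size i) j.
      rewrite -[LHS](cat_take_drop (size i)); congr (_ ++ _).
      have := congr1 (take (size i)) e.
      by rewrite take_size_cat // takel_cat.
    rewrite jE; case: si => [si|s0].
      by rewrite (cut_pre i (drop (size i) j)) ?cats0 -?jE.
    rewrite drop_oversize ?cats0 //.
    by move/(congr1 size): e; rewrite s0 cats0 size_cat => ->; apply: leq_addr.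
  have iE : i = j ++ drop (size j) i.
    rewrite -[LHS](cat_take_drop (size j)); congr (_ ++ _).
    have := congr1 (take (size j)) e.
    by rewrite takel_cat ?(ltnW ji) // take_size_cat.
  rewrite iE; case: tj => [tj|t0].
    by rewrite (cut_pre j (drop (size j) i)) ?cats0 -?iE.
  move: ji; have := congr1 size e; rewrite t0 cats0 size_cat => <-.
  by rewrite ltnNge leq_addr.
have Bl i : i \in hs -> B i `<=` leaf p E H.
  move=> /hsl[[Hi ci] li]; rewrite /B; case: ifP => [iY _ [t lt <-]|iY _ ->].
    by rewrite -leaf_sub //; apply: nE.
  by split=> //; move: li; rewrite stoppedU iY.
have := @pval_disjoint _ _ (enum {: bool * P}) (label p E) (enum_uniq _) _
  (weight eps) (leaf p E H) _ hs B uhs Bl Bdis.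
move=> /(_ _)/nle_trans; apply; first by move=> h; rewrite mem_enum.
rewrite !big_seq; apply: nle_prod => h /hsl[ch lh].
rewrite /B; case: ifP => hY.
  apply: nle_trans (val_sub _ _ _ (nE _ hY)) _.
  rewrite /weight /label stoppedU hY /=; exact: leY.
apply: nle_trans (pval_set1 _ _ _ _) _; first exact: enum_uniq.
  by move=> k; rewrite mem_enum.
rewrite /weight /label stoppedU hY /=; case: ifP => hE; last exact: nle_refl.
by apply: ee'; apply: stopped_last.
Qed.

(** * Substituting trees at the exits to one position *)

Lemma mkseqSr (T : Type) (g : nat -> T) n : mkseq g n.+1 = rcons (mkseq g n) (g n).
Proof. by rewrite -addn1 mkseqD cats1 addn0. Qed.

Lemma last_branch f n : last (f 0%N) (mkseq (fun i => f i.+1) n) = f n.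
Proof. by case: n => // n; rewrite mkseqSr last_rcons. Qed.

(* Follow [H] up to the first visit to [y], say after [u], then [sigma u]. *)
Definition glue y H (sigma : seq P -> set (seq P)) : set (seq P) :=
  fun h => if y \in h then
    let u := take (index y h).+1 h in H u /\ sigma u (drop (index y h).+1 h)
  else H h.

Lemma first_occurrence y h : y \in h ->
  exists u d, h = rcons u y ++ d /\ y \notin u.
Proof.
move=> yh; exists (take (index y h) h), (drop (index y h).+1 h); split.
  rewrite -[LHS](cat_take_drop (index y h).+1); congr (_ ++ _).
  by rewrite (take_nth y) ?index_mem // nth_index.
by apply/negP => /(index_ltn); rewrite ltnn.
Qed.

Lemma index_rcons_cat y u d : y \notin u -> index y (rcons u y ++ d) = size u.
Proof. by move=> yu; rewrite cat_rcons index_cat (negbTE yu) /= eqxx addn0. Qed.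

Lemma take_index_rcons_cat y u d : y \notin u ->
  take (index y (rcons u y ++ d)).+1 (rcons u y ++ d) = rcons u y.
Proof. by move=> yu; rewrite index_rcons_cat // take_size_cat // size_rcons. Qed.

Lemma glue_before y H sigma h : y \notin h -> glue y H sigma h = H h.
Proof. by rewrite /glue => /negbTE ->. Qed.

Lemma glue_after y H sigma u d : y \notin u ->
  glue y H sigma (rcons u y ++ d) = (H (rcons u y) /\ sigma (rcons u y) d).
Proof.
move=> yu; rewrite /glue mem_cat mem_rcons mem_head /= take_index_rcons_cat //.
by rewrite index_rcons_cat // drop_size_cat // size_rcons.
Qed.

Lemma stopped1_before y h : y \notin h -> stopped [set y]%SET h = false.
Proof.
case: h => //= q h yh; rewrite finset.in_set1; apply/eqP => e.
by move: yh; rewrite -e mem_last.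
Qed.

Lemma wtree_glue p E y H sigma : y \notin E -> wtree p (y |: E) H ->
  (forall u, y \notin u -> H (rcons u y) -> wtree y E (sigma (rcons u y))) ->
  wtree p E (glue y H sigma).
Proof.
move=> yE [tH wH] ws.
(* This includes [q = y]: the glued tree then continues with the empty history of the tree
   [sigma (rcons h y)]. *)
have beforer h q : y \notin h -> glue y H sigma (rcons h q) <-> H (rcons h q).
  move=> yh; have [->|qy] := eqVneq q y.
    rewrite -[in glue _ _ _ _](cats0 (rcons h y)) glue_after //.
    by split=> [[//]|Hy]; split=> //; apply: tree_nil (ws h yh Hy).1.
  by rewrite glue_before // mem_rcons inE eq_sym negb_or qy.
have stopb h : y \notin h -> stopped (y |: E) h = stopped E h.
  by move=> yh; rewrite stoppedU stopped1_before.
have stopa u d : stopped E (rcons u y ++ d) = stopped E d.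
  by rewrite stopped_cat // stopped_rcons.
have lasta u d : last p (rcons u y ++ d) = last y d by rewrite last_cat last_rcons.
split; first split.
- by rewrite glue_before //; apply: tree_nil tH.
- move=> h q; have [yh|yh] := boolP (y \in h).
    have [u [d [-> yu]]] := first_occurrence yh.
    rewrite rcons_cat !glue_after // => -[Hy].
    by move=> /(tree_rcons (ws u yu Hy).1)[sd dE dq]; rewrite stopa lasta.
  move=> /(beforer h q yh)/(tree_rcons tH)[Hh hE hq].
  by rewrite glue_before // -stopb.
- move=> h; have [yh|yh] := boolP (y \in h).
    have [u [d [-> yu]]] := first_occurrence yh.
    rewrite glue_after // stopa lasta => -[Hy sd] dE vd.
    have [q sq] := tree_verif (ws u yu Hy).1 sd dE vd; exists q.
    by rewrite rcons_cat glue_after.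
  rewrite glue_before // -stopb // => Hh hE vh.
  have [q Hq] := tree_verif tH Hh hE vh; exists q; exact/beforer.
- move=> h q q' vh; have [yh|yh] := boolP (y \in h).
    have [u [d [e yu]]] := first_occurrence yh; move: vh.
    rewrite e !rcons_cat !glue_after // lasta => vd [Hy sq] [_ sq'].
    exact: (tree_verif_uniq (ws u yu Hy).1 vd).
  move=> /beforer h1 /beforer h2.
  exact: (tree_verif_uniq tH vh (h1 yh) (h2 yh)).
- move=> h q; have [yh|yh] := boolP (y \in h).
    have [u [d [-> yu]]] := first_occurrence yh.
    rewrite rcons_cat !glue_after // stopa lasta => -[Hy sd] dE vd dq; split=> //.
    exact: (tree_falsif (ws u yu Hy).1).
  rewrite glue_before // -stopb // => Hh hE vh hq; apply/beforer => //.
  exact: (tree_falsif tH).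
(* After its first visit to [y], a branch is a branch of one of the trees [sigma u]; without such a
   visit, it is a branch of [H]. *)
move=> f [f0 fH]; have [[i fi]|noy] := pselect (exists i, f i.+1 == y).
  have [k /eqP fk kmin] := ex_minnP (ex_intro (fun i => f i.+1 == y) i fi).
  have yk : y \notin mkseq (fun i => f i.+1) k.
    apply/negP => /mapP[j]; rewrite mem_iota add0n => /andP[_ jk] e.
    by move: (kmin j); rewrite -e eqxx leqNgt jk => /(_ isT).
  have Hk n : H (rcons (mkseq (fun i => f i.+1) k) y) /\
      sigma (rcons (mkseq (fun i => f i.+1) k) y) (mkseq (fun i => f (k.+1 + i.+1)%N) n).
    rewrite -glue_after // -{2}fk -mkseqSr.
    have -> : mkseq (fun i => f (k.+1 + i.+1)%N) n = mkseq (fun i => f (k.+1 + i).+1) n.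
      by apply: eq_map => j; rewrite addnS.
    by rewrite -(mkseqD (fun i => f i.+1)).
  apply/(won_shift f k.+1); apply: (ws _ yk (Hk 0%N).1).2.
  by split=> [|n]; [rewrite addn0|apply: (Hk n).2].
apply: wH; split=> // n; have := fH n; rewrite glue_before //.
by apply/negP => /mapP[j _ e]; apply: noy; exists j; rewrite -e.
Qed.

Definition upd eps y (v : K) q := if q == y then v else eps q.

Definition exits y H : set (seq P) := [set u | H u /\ stopped [set y]%SET u].

(** The exits to [y] are exactly the leaves labelled [(true, y)], and no other label sees the value
    at [y]. The factor of this label is therefore split off. *)
Lemma val_exits p E y eps v H : y \in E ->
  val p E (upd eps y v) H ⊑ val p E (upd eps y 1) H * epow v (ecard (exits y H)).
Proof.
move=> yE; rewrite /val /pval !(bigD1_seq (true, y)) ?mem_enum ?enum_uniq //=.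
rewrite [X in X * _]/= /weight /upd /= eqxx epow1 mul1r mulrC.
apply: nle_mul.
  apply: nle_prod => -[b q] /=; rewrite xpair_eqE.
  case: b => /= [|_]; last exact: nle_refl.
  by case: (eqVneq q y) => // _ _; apply: nle_refl.
rewrite [X in epow _ (ecard X) ⊑ _](_ : _ = exits y H); first exact: nle_refl.
apply/seteqP; split=> h /=.
  move=> [[Hh _] []]; case: h Hh => //= q h Hh _ e; split=> //=.
  by rewrite e finset.in_set1.
move=> [Hh hy]; have e : last p h = y.
  by move/(stopped_last p): hy; rewrite finset.in_set1 => /eqP.
have hE : stopped E h by case: h hy Hh e => //= q h _ _ ->.
by split; rewrite /leaf /label /= ?hE ?e.
Qed.

Lemma weight_upd1 p E y eps v h : y \notin h ->
  weight (upd eps y v) (label p (y |: E) h) = weight eps (label p E h).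
Proof.
move=> yh; rewrite /label stoppedU stopped1_before //= /weight /=.
case: ifP => // hE; rewrite /upd; case: eqVneq => // e.
by case: h yh hE e => //= q h + _ e; rewrite -e mem_last.
Qed.

(** Leaves of the glued tree that avoid [y] are leaves of [H]. The others are grouped by the exit of
    [H] they pass through; a finite product meets only finitely many exits, so the assumption on [v]
    concerns finite lists, even when [H] has infinitely many exits. *)
Lemma val_glue p E y H sigma eps (v : K) : y \notin E ->
  (forall us, uniq us -> (forall u, u \in us -> exits y H u) ->
     v ⊑ \prod_(u <- us) val y E eps (sigma u)) ->
  val p (y |: E) (upd eps y 1) H * v ⊑ val p E eps (glue y H sigma).
Proof.
move=> yE vle; apply: val_ge => hs uhs hsl.
rewrite (bigID (fun h => y \notin h)) /=; apply: nle_mul.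
  rewrite -big_filter; have := @val_le p (y |: E) (upd eps y 1) H
    [seq h <- hs | y \notin h] (filter_uniq _ uhs).
  move=> /(_ _)/nle_trans; apply.
    move=> h; rewrite mem_filter => /andP[yh /hsl[]]; rewrite glue_before // => Hh lh.
    by split=> //; rewrite stoppedU stopped1_before.
  rewrite !big_filter; apply: nle_prod => h yh; rewrite weight_upd1 //.
  exact: nle_refl.
pose k h := take (index y h).+1 h.
have hsP h : h \in hs -> y \in h -> exists u d, [/\ h = rcons u y ++ d,
    k h = rcons u y, exits y H (rcons u y) & leaf y E (sigma (rcons u y)) d].
  move=> /hsl[+ lh] /first_occurrence[u [d [hE yu]]].
  rewrite hE glue_after // => -[Hy sd]; exists u, d; split=> //.
  - by rewrite /k take_index_rcons_cat.
  - by split=> //; rewrite stopped_rcons finset.in_set1.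
  - split=> //; move: lh; rewrite hE stopped_cat ?stopped_rcons //.
    by rewrite last_cat last_rcons.
pose ks := undup (map k [seq h <- hs | ~~ (y \notin h)]).
have uks : uniq ks by apply: undup_uniq.
rewrite -big_filter (prod_group (k := k) _ uks); last first.
  by move=> h hh; rewrite mem_undup; apply: map_f.
apply: nle_trans (vle ks uks _) _.
  move=> w; rewrite mem_undup => /mapP[h].
  by rewrite mem_filter negbK => /andP[yh /hsP/(_ yh)[u [d [_ -> ? _]]] ->].
rewrite big_seq [X in _ ⊑ X]big_seq; apply: nle_prod => w.
rewrite mem_undup => /mapP[h0]; rewrite mem_filter negbK => /andP[yh0 /hsP/(_ yh0)].
move=> [u0 [d0 [_ -> _ _]]] ->; rewrite -big_filter.
apply: (val_le_group (u := rcons u0 y)); first by rewrite !filter_uniq.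
move=> h; rewrite !mem_filter negbK => /andP[/eqP hw /andP[yh /hsP/(_ yh)]].
move=> [u [d [hE ku _ ld]]]; move: hw; rewrite ku => wE; exists d.
rewrite -wE; split=> //; rewrite hE label_cat ?stopped_rcons // last_rcons.
exact: nle_refl.
Qed.

(** With finitely many exits, the power of the sum over [N] is expanded into a sum over the choices
    of a tree for each exit. With infinitely many, [infpow_sum] bounds the infinite power of the sum
    by a sum in which each term uses one tree at every exit. In both cases [Ms] does not depend on
    [eps]. *)
Lemma subst_exit1 p E y N H : y \notin E -> (forall s, s \in N -> wtree y E s) ->
  wtree p (y |: E) H -> exists Ms, (forall s, s \in Ms -> wtree p E s) /\
    forall eps, val p (y |: E) (upd eps y (valsum y E eps N)) H ⊑ valsum p E eps Ms.
Proof.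
move=> yE wN wH; have [fx|ix] := pselect (finite_set (exits y H)).
  have memx u : (u \in fset_set (exits y H)) <-> exits y H u.
    by rewrite in_fset_set // inE.
  have [fs [fsN fsE]] := prod_sum_seq set0 (fun=> N) (fset_uniq (fset_set (exits y H))).
  exists [seq glue y H s | s <- fs]; split.
    move=> _ /mapP[s sfs ->]; apply: wtree_glue => // u yu Hu; apply: wN.
    apply: (fsN s sfs); apply/memx; split=> //.
    by rewrite stopped_rcons finset.in_set1.
  move=> eps; apply: nle_trans (val_exits _ _ _ _ (setU11 _ _)) _.
  rewrite /ecard asboolT //= -(prod_const_mem (F := fun=> valsum y E eps N)) //.
  rewrite fsE mulr_sumr /valsum big_map; apply: nle_sum => s _.
  apply: val_glue => // us uus usx; apply: nle_prod_uniq_sub => // u /usx.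
  by move/memx.
exists [seq glue y H (fun=> s) | s <- N]; split.
  by move=> _ /mapP[s sN ->]; apply: wtree_glue => // *; apply: wN.
move=> eps; apply: nle_trans (val_exits _ _ _ _ (setU11 _ _)) _.
rewrite /ecard asboolF //=; apply: nle_trans (nle_mul (nle_refl _) (infpow_sum _ _)) _.
rewrite mulr_sumr /valsum big_map; apply: nle_sum => s _.
apply: val_glue => // us uus usx.
by rewrite (prod_const_mem (a := val y E eps s)) //; apply: infpow_le.
Qed.

Lemma subst_exit p E y N Hs : y \notin E -> (forall s, s \in N -> wtree y E s) ->
  (forall H, H \in Hs -> wtree p (y |: E) H) ->
  exists Ms, (forall s, s \in Ms -> wtree p E s) /\
    forall eps, valsum p (y |: E) (upd eps y (valsum y E eps N)) Hs ⊑ valsum p E eps Ms.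
Proof.
move=> yE wN; elim: Hs => [|H Hs IH] wHs.
  by exists [::]; split=> // eps; rewrite /valsum !big_nil; apply: nle_refl.
have [|Ms [wMs leMs]] := IH; first by move=> s SHs; apply: wHs; rewrite inE SHs orbT.
have [Ms' [wMs' leMs']] := subst_exit1 yE wN (wHs H (mem_head _ _)).
exists (Ms' ++ Ms); split=> [s|eps].
  by rewrite mem_cat => /orP[/wMs'|/wMs].
by rewrite /valsum big_cat big_cons; apply: nle_add; [apply: leMs'|apply: leMs].
Qed.

(* The part of [h] that follows the last visit to [y]. *)
Definition since y h := foldl (fun s q => if q == y then [::] else rcons s q) [::] h.

Lemma since_rcons y h q :
  since y (rcons h q) = if q == y then [::] else rcons (since y h) q.
Proof. by rewrite /since -cats1 foldl_cat. Qed.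

Lemma since_notin y h : y \notin since y h.
Proof.
elim/last_ind: h => //= h q IH; rewrite since_rcons; case: eqVneq => //= qy.
by rewrite mem_rcons inE negb_or eq_sym qy.
Qed.

Lemma last_since y h : last y (since y h) = last y h.
Proof.
case/lastP: h => // h q; rewrite since_rcons last_rcons.
by case: eqVneq => [->|_]; rewrite ?last_rcons.
Qed.

Lemma since_suffix y h : h = take (size h - size (since y h)) h ++ since y h.
Proof.
have [u hE] : exists u, h = u ++ since y h.
  elim/last_ind: h => [|h q [u IH]]; first by exists [::].
  rewrite since_rcons; case: eqVneq => [->|_].
    by exists (rcons h y); rewrite cats0.
  by exists u; rewrite -rcons_cat -IH.
have sz := congr1 size hE; rewrite size_cat in sz.
by rewrite sz addnK [X in take _ X]hE take_size_cat.
Qed.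

Lemma since_id y h : y \notin h -> since y h = h.
Proof.
elim/last_ind: h => // h q IH; rewrite mem_rcons inE negb_or => /andP[yq /IH e].
by rewrite since_rcons eq_sym (negbTE yq) e.
Qed.

Lemma since_rcons_cat y u h : y \notin h -> since y (rcons u y ++ h) = h.
Proof.
elim/last_ind: h => [|h q IH]; first by rewrite cats0 since_rcons eqxx.
rewrite mem_rcons inE negb_or => /andP[yq /IH e].
by rewrite -rcons_cat since_rcons e eq_sym (negbTE yq).
Qed.

Lemma stopped_since E y h : y \notin E -> stopped E (since y h) = stopped E h.
Proof.
move=> yE; case/lastP: h => // h q; rewrite since_rcons stopped_rcons.
by case: eqVneq => [->|_]; rewrite ?stopped_rcons // (negbTE yE).
Qed.

(* Restart [H] at its root [y] whenever [y] is reached. *)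
Definition omega y H : set (seq P) := [set h |
  forall h1 q h2, h = rcons h1 q ++ h2 -> H (rcons (since y h1) q)].

Lemma omega_nil y H : omega y H [::].
Proof. by move=> h1 q h2 /(congr1 size); rewrite size_cat size_rcons. Qed.

Lemma omega_rcons y H h q :
  omega y H (rcons h q) <-> omega y H h /\ H (rcons (since y h) q).
Proof.
split=> [Hq|[Hh Hq]].
  split=> [h1 q1 h2 hE|]; first by apply: (Hq h1 q1 (rcons h2 q)); rewrite -rcons_cat -hE.
  by apply: (Hq h q [::]); rewrite cats0.
move=> h1 q1; case/lastP => [|h2 q2].
  by rewrite cats0 => /rcons_inj[<- <-].
by rewrite -rcons_cat => /rcons_inj[hE _]; apply: Hh hE.
Qed.

Lemma omega_since y H h : H [::] -> omega y H h -> H (since y h).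
Proof.
move=> H0; case/lastP: h => // h q /omega_rcons[_].
by rewrite since_rcons; case: eqVneq.
Qed.

(** * Priorities on plays with recurring visits; winning and value of restarted trees *)

Lemma branch_step p E H f i : tree p E H -> branch p H f ->
  step (f i) (f i.+1) /\ f i.+1 \notin E.
Proof.
move=> tH [f0 fH]; have [_ _] := tree_rcons tH (eq_ind _ H (fH i.+1) _ (mkseqSr _ i)).
have [_ + _] := tree_rcons tH (eq_ind _ H (fH i.+2) _ (mkseqSr _ i.+1)).
by rewrite mkseqSr stopped_rcons -f0 last_branch.
Qed.

Lemma path_branch f i n : (forall i, step (f i) (f i.+1)) ->
  path step (f i) (mkseq (fun k => f (i + k).+1) n).
Proof.
move=> fs; elim: n => // n IH; rewrite mkseqSr rcons_path IH.
have -> : last (f i) (mkseq (fun k => f (i + k).+1) n) = f (i + n)%N.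
  by case: n {IH} => [|n]; rewrite ?addn0 // mkseqSr last_rcons addnS.
exact: fs.
Qed.

(** Segments are half-open, [y :: h] without [y'], so that consecutive ones tile a play. For the
    positions of a fixed-point variable, [c] is going to be its priority. *)
Definition min_priority Y E (c : nat) := forall y y' h, y \in Y -> y' \in Y ->
  path step y (rcons h y') -> all (fun q => q \notin E) h ->
  (forall q k, q \in y :: h -> priority (nd q) = Some k -> (c <= k)%N) /\
  exists2 q, q \in y :: h & priority (nd q) = Some c.

(** The visits to [Y] divide the play into segments of least priority [c]. Hence [c] recurs, and
    after the first visit no smaller priority occurs. *)
Lemma recurs_min_priority Y E c f : min_priority Y E c ->
  (forall i, step (f i) (f i.+1)) -> (forall i, f i.+1 \notin E) ->
  (forall n, exists2 k, (n <= k)%N & f k \in Y) ->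
  recurs f c /\ forall c' : nat, (c' < c)%N -> ~ recurs f c'.
Proof.
move=> Yc fs fE fY.
have Yij i j : (i < j)%N -> f i \in Y -> f j \in Y ->
    let h := mkseq (fun k => f (i + k).+1) (j - i).-1 in
    (forall q k, q \in f i :: h -> priority (nd q) = Some k -> (c <= k)%N) /\
    exists2 q, q \in f i :: h & priority (nd q) = Some c.
  move=> ij fi fj h; apply: Yc fi fj _ _; last first.
    by apply/allP => q /mapP[k _ ->]; apply: fE.
  have -> : rcons h (f j) = mkseq (fun k => f (i + k).+1) (j - i).-1.+1.
    by rewrite mkseqSr -addnS prednK ?subn_gt0 // subnKC // ltnW.
  exact: path_branch.
have memh i j k : (i <= k < j)%N ->
    f k \in f i :: mkseq (fun k => f (i + k).+1) (j - i).-1.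
  case/andP; rewrite leq_eqVlt => /orP[/eqP -> _|ik kj]; first exact: mem_head.
  rewrite inE; apply/orP; right; apply/mapP; exists (k - i.+1)%N.
    by rewrite mem_iota /= add0n -subnS ltn_sub2r // (leq_ltn_trans ik).
  by rewrite -addSn subnKC.
split=> [n|c' c'c rc'].
  have [i ni fi] := fY n; have [j ij fj] := fY i.+1.
  have [_ [q + qc]] := Yij i j ij fi fj.
  rewrite inE => /orP[/eqP qE|/mapP[k _ qE]]; first by exists i; rewrite // -qE.
  by exists (i + k).+1; rewrite -?qE // (leq_trans ni) // -addnS leq_addr.
have [i _ fi] := fY 0%N; have [k ik fk] := rc' i; have [j kj fj] := fY k.+1.
have [cmin _] := Yij i j (leq_ltn_trans ik kj) fi fj.
by move: c'c; rewrite ltnNge (cmin _ _ _ fk) // memh // ik kj.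
Qed.

(** A branch with infinitely many restarts has the even [c] as its least recurring priority. A
    branch with finitely many is, from its last visit to [y] on, a branch of the winning tree
    [H]. *)
Lemma wtree_omega y E c H : y \notin E -> ~~ odd c -> min_priority [set y]%SET E c ->
  wtree y (y |: E) H -> wtree y E (omega y H).
Proof.
move=> yE oc yc [tH wH].
have stopb h : stopped (y |: E) (since y h) = stopped E h.
  by rewrite stoppedU stopped1_before ?since_notin ?stopped_since.
have H0 := tree_nil tH.
have tO : tree y E (omega y H).
  split.
  - exact: omega_nil.
  - move=> h q /omega_rcons[Oh /(tree_rcons tH)[_]].
    by rewrite stopb last_since.
  - move=> h Oh; rewrite -stopb -last_since => hE vh.
    have [q Hq] := tree_verif tH (omega_since H0 Oh) hE vh.
    by exists q; apply/omega_rcons.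
  - move=> h q q'; rewrite -last_since => vh /omega_rcons[_ h1] /omega_rcons[_ h2].
    exact: (tree_verif_uniq tH vh).
  - move=> h q Oh; rewrite -stopb -last_since => hE vh hq.
    apply/omega_rcons; split=> //.
    exact: (tree_falsif tH (omega_since H0 Oh)).
split=> // f bf; have fs i := branch_step i tO bf.
have [rec|] := pselect (forall n, exists2 k, (n <= k)%N & f k \in [set y]%SET).
  have [fc cmin] := recurs_min_priority yc (fun i => (fs i).1) (fun i => (fs i).2) rec.
  by exists c.
move=> /existsNP[n nrec].
have [f0 fO] := bf.
have bound i : f i == y -> (i <= n)%N.
  move=> /eqP fi; rewrite leqNgt; apply/negP => ni; apply: nrec.
  by exists i; rewrite ?finset.in_set1 ?fi // ltnW.
have [i /eqP fi imax] := ex_maxnP (ex_intro (fun i => f i == y) 0%N (introT eqP f0)) bound.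
apply/(won_shift f i); apply: wH; split=> [|m]; first by rewrite addn0.
have ym : y \notin mkseq (fun k => f (i + k.+1)%N) m.
  apply/negP => /mapP[k _ yk]; have := imax (i + k.+1)%N.
  by rewrite -yk eqxx addnS ltnNge leq_addr => /(_ isT).
have := omega_since H0 (fO (i + m)%N); rewrite mkseqD.
have -> : mkseq (fun k => f (i + k).+1) m = mkseq (fun k => f (i + k.+1)%N) m.
  by apply: eq_map => k; rewrite addnS.
(* For [i = 0] the last visit is the root, which is not recorded in histories. *)
case: i fi {imax} ym => [|i] fi ym; first by rewrite since_id.
by rewrite mkseqSr fi since_rcons_cat.
Qed.

(** Grouped by the prefix up to the last visit to [y], the leaves of the restarted tree become
    leaves of [H]. Finitely many leaves form finitely many groups, and the infinite power is below
    the corresponding finite one. *)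
Lemma val_omega y E H eps : y \notin E -> H [::] ->
  infpow (val y (y |: E) (upd eps y 1) H) ⊑ val y E eps (omega y H).
Proof.
move=> yE H0; apply: val_ge => hs uhs hsl.
pose k h := take (size h - size (since y h)) h.
rewrite (prod_group (k := k) _ (undup_uniq (map k hs))); last first.
  by move=> h hh; rewrite mem_undup; apply: map_f.
apply: nle_trans (infpow_le _ (size (undup (map k hs)))) _.
rewrite -(prod_const_mem (F := fun=> val y (y |: E) (upd eps y 1) H)) //.
apply: nle_prod => u _; rewrite -big_filter.
apply: (val_le_group (u := u)); first exact: filter_uniq.
move=> h; rewrite mem_filter => /andP[/eqP <- /hsl[Oh lh]]; exists (since y h).
split; first exact: since_suffix.
  split; first exact: omega_since.
  by rewrite stoppedU stopped1_before ?since_notin // stopped_since // last_since.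
rewrite weight_upd1 ?since_notin // /label stopped_since // last_since.
exact: nle_refl.
Qed.

Definition updl eps (ys : seq P) (b : P -> K) q := if q \in ys then b q else eps q.

Lemma updl_cons eps y ys b q :
  updl eps (y :: ys) b q = upd (updl eps ys b) y (b y) q.
Proof. by rewrite /updl /upd inE; case: eqVneq => [->|]. Qed.

Lemma val_eq p E eps eps' H : (forall q, q \in E -> eps q = eps' q) ->
  val p E eps H = val p E eps' H.
Proof.
move=> ee; apply: nle_anti; apply: val_ge => hs uhs hsl;
  apply: nle_trans (val_le _ uhs hsl) _; apply: nle_prod => h _;
  rewrite /weight /label /=; case: ifP => [/(stopped_last p)/ee ->|_];
  exact: nle_refl.
Qed.

Lemma valsum_eq p E eps eps' Hs : (forall q, q \in E -> eps q = eps' q) ->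
  valsum p E eps Hs = valsum p E eps' Hs.
Proof. by move=> ee; apply: eq_bigr => H _; apply: val_eq. Qed.

Lemma valsum_mono p E eps eps' Hs : (forall q, q \in E -> eps q ⊑ eps' q) ->
  valsum p E eps Hs ⊑ valsum p E eps' Hs.
Proof.
move=> ee; apply: nle_sum => H _; apply: val_ge => hs uhs hsl.
apply: nle_trans (val_le _ uhs hsl) _; apply: nle_prod => h _.
rewrite /weight /label /=; case: ifP => [/(stopped_last p)/ee //|_].
exact: nle_refl.
Qed.

(** * Trees with and without exits to a position *)

Definition no_exit y H := forall u, ~ exits y H u.

Lemma no_exitE p y E H : tree p (y |: E) H -> no_exit y H ->
  forall h, H h -> stopped (y |: E) h = stopped E h.
Proof.
move=> tH nH h Hh; rewrite stoppedU; case hy: (stopped _ h) => //.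
by case: (nH h).
Qed.

Lemma wtree_no_exit p y E H : wtree p (y |: E) H -> no_exit y H -> wtree p E H.
Proof.
move=> [tH wH] nH; split=> //; have e := no_exitE tH nH; split.
- exact: tree_nil tH.
- move=> h q Hq; have [Hh hE hq] := tree_rcons tH Hq; split=> //.
  by rewrite -e.
- by move=> h Hh hE; apply: (tree_verif tH) => //; rewrite e.
- exact: (tree_verif_uniq tH).
- by move=> h q Hh hE; apply: (tree_falsif tH) => //; rewrite e.
Qed.

Lemma val_no_exit p y E H eps v : tree p (y |: E) H -> no_exit y H ->
  val p (y |: E) (upd eps y v) H ⊑ val p E eps H.
Proof.
move=> tH nH; have e := no_exitE tH nH.
apply: val_ge => hs uhs hsl.
apply: nle_trans (val_le _ uhs _) _.
  by move=> h /hsl[Hh lh]; split=> //; rewrite e.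
rewrite !big_seq; apply: nle_prod => h /hsl[Hh lh].
rewrite /weight /label e //=; case: ifP => hE; last exact: nle_refl.
rewrite /upd; case: eqVneq => [hy|_]; last exact: nle_refl.
case: (nH h); split=> //; case: h hE hy {Hh lh} => //= q h _ ->.
by rewrite finset.in_set1.
Qed.

(** With at least one exit, at least one factor [v] occurs, and any further ones are below [1]. This
    is the linear part of the affine bound used for elimination. *)
Lemma val_exit p y E H eps v : ~ no_exit y H ->
  val p (y |: E) (upd eps y v) H ⊑ val p (y |: E) (upd eps y 1) H * v.
Proof.
move=> /existsNP[u /contrapT xu]; apply: nle_trans (val_exits _ _ _ _ (setU11 _ _)) _.
apply: nle_mul (nle_refl _) _.
apply: nle_trans (epow_ecard_le (s := [:: u]) _ _ _) _ => //.
  by move=> w; rewrite inE => /eqP ->.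
by rewrite expr1; apply: nle_refl.
Qed.

(** * Elimination of exits *)

Lemma choice_seq (Q : P -> seq (set (seq P)) -> Prop) (Z : seq P) :
  (forall p, p \in Z -> exists Ms, Q p Ms) ->
  exists M, forall p, p \in Z -> Q p (M p).
Proof.
move=> ex; have [p|M MP] := @choice _ _ (fun p Ms => p \in Z -> Q p Ms); last by exists M.
by have [/ex[Ms QMs]|] := boolP (p \in Z); [exists Ms|exists [::]].
Qed.

Definition wtrees p E (Hs : seq (set (seq P))) := forall H, H \in Hs -> wtree p E H.

(** Take for [v] the sum over the trees from [y] without an exit to [y]. A tree with an exit
    contributes at most a multiple of [v], which is below [v], so [v] is a prefixed point of the
    equation; being a sum of values of winning trees, it can be substituted. *)
Lemma eliminate_lfp1 y E (Z : seq P) M : y \notin E -> y \in Z ->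
  (forall p, p \in Z -> wtrees p (y |: E) (M p)) ->
  exists M', (forall p, p \in Z -> wtrees p E (M' p)) /\
  forall eps, exists v : K,
    (forall p, p \in Z ->
       valsum p (y |: E) (upd eps y v) (M p) ⊑ valsum p E eps (M' p)) /\
    valsum y (y |: E) (upd eps y v) (M y) ⊑ v.
Proof.
move=> yE yZ wM; pose N := [seq H <- M y | `[< no_exit y H >]].
have wN : wtrees y E N.
  move=> H; rewrite mem_filter => /andP[/asboolP nH HM].
  exact: wtree_no_exit (wM y yZ H HM) nH.
have [M' M'P] := choice_seq (fun p pZ => subst_exit yE wN (wM p pZ)).
exists M'; split=> [p /M'P[]//|eps]; exists (valsum y E eps N).
split=> [p /M'P[_]//|]; rewrite {1}/valsum big_seq; apply: nle_sum_lub => H HM.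
have [nH|nH] := pselect (no_exit y H); last first.
  by apply: nle_trans (val_exit _ _ _ _ nH) _; apply: nle_mull.
apply: nle_trans (val_no_exit _ _ (wM y yZ H HM).1 nH) _.
apply: (nle_sum_mem (fun H => val y E eps H)).
by rewrite mem_filter HM andbT; apply/asboolP.
Qed.

(** Every postfixed [v] is below the greatest solution of the affine equation, a sum of values of
    winning trees: those without an exit to [y], and the restarted ones for the infinite power. *)
Lemma eliminate_gfp1 y E c (Z : seq P) M : y \notin E -> y \in Z ->
  ~~ odd c -> min_priority [set y]%SET E c ->
  (forall p, p \in Z -> wtrees p (y |: E) (M p)) ->
  exists M', (forall p, p \in Z -> wtrees p E (M' p)) /\
  forall eps v, v ⊑ valsum y (y |: E) (upd eps y v) (M y) ->
    forall p, p \in Z ->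
      valsum p (y |: E) (upd eps y v) (M p) ⊑ valsum p E eps (M' p).
Proof.
move=> yE yZ oc yc wM; pose e H := `[< no_exit y H >].
pose N := [seq H <- M y | e H] ++ [seq omega y H | H <- M y & ~~ e H].
have wN : wtrees y E N.
  move=> H; rewrite mem_cat => /orP[|/mapP[H']]; rewrite mem_filter => /andP[].
    by move=> /asboolP nH HM; apply: wtree_no_exit (wM y yZ H HM) nH.
  by move=> _ HM ->; apply: wtree_omega yE oc yc (wM y yZ _ HM).
have [M' M'P] := choice_seq (fun p pZ => subst_exit yE wN (wM p pZ)).
exists M'; split=> [p /M'P[]//|eps v vle p pZ].
apply: nle_trans ((M'P p pZ).2 eps); apply: valsum_mono => q _.
rewrite /upd; case: eqVneq => [_|_]; last exact: nle_refl.
(* The trees without an exit give the constant term of the affine equation, the others, with exit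
   value [1], its coefficient. *)
apply: (@nle_trans (\sum_(H <- M y | e H) val y E eps H +
  infpow (\sum_(H <- M y | ~~ e H) val y (y |: E) (upd eps y 1) H))).
  apply: postfix_affine; apply: nle_trans vle _.
  rewrite /valsum (bigID e) /= mulr_suml.
  apply: nle_add; rewrite big_seq_cond [X in _ ⊑ X]big_seq_cond.
    apply: nle_sum => H /andP[HM /asboolP nH].
    exact: val_no_exit (wM y yZ H HM).1 nH.
  by apply: nle_sum => H /andP[HM /asboolP nH]; apply: val_exit.
rewrite /valsum big_cat big_map !big_filter; apply: nle_add; first exact: nle_refl.
rewrite -[X in infpow X]big_filter; apply: nle_trans (infpow_sum _ _) _.
rewrite big_filter big_seq_cond [X in _ ⊑ X]big_seq_cond.
apply: nle_sum => H /andP[HM _]; apply: val_omega => //.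
exact: tree_nil (wM y yZ H HM).1.
Qed.

Definition addl (ys : seq P) E := foldr (fun y F => y |: F) E ys.

Lemma mem_addl ys E q : (q \in addl ys E) = (q \in ys) || (q \in E).
Proof.
by elim: ys => //= y ys IH; rewrite finset.in_setU finset.in_set1 IH inE orbA.
Qed.

(** Gaussian elimination: [y] is eliminated first, the induction solves the remaining equations by
    [b], and the value at [y] is obtained by back substitution. *)
Lemma eliminate_lfp ys E (Z : seq P) M : uniq ys -> {subset ys <= Z} ->
  (forall y, y \in ys -> y \notin E) ->
  (forall p, p \in Z -> wtrees p (addl ys E) (M p)) ->
  exists M', (forall p, p \in Z -> wtrees p E (M' p)) /\
  forall eps, exists b : P -> K,
    (forall p, p \in Z ->
       valsum p (addl ys E) (updl eps ys b) (M p) ⊑ valsum p E eps (M' p)) /\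
    (forall y, y \in ys -> valsum y (addl ys E) (updl eps ys b) (M y) ⊑ b y).
Proof.
elim: ys M => [|y ys IH] M.
  by move=> _ _ _ wM; exists M; split=> // eps; exists eps; split=> // p _; apply: nle_refl.
rewrite cons_uniq => /andP[yys uys] ysZ ysE wM.
have yE : y \notin addl ys E.
  by rewrite mem_addl negb_or yys ysE ?mem_head.
have [M1 [wM1 M1P]] := eliminate_lfp1 yE (ysZ y (mem_head _ _)) wM.
have [|z zys|M2 [wM2 M2P]] := IH M1 uys _ _ wM1.
- by move=> z zys; apply: ysZ; rewrite inE zys orbT.
- by apply: ysE; rewrite inE zys orbT.
exists M2; split=> // eps; have [b [bM bb]] := M2P eps.
(* The value [v] is taken at the exit values where the remaining positions already have their
   solution [b]. *)
have [v [vM vv]] := M1P (updl eps ys b).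
pose b' q := if q == y then v else b q.
have upE p : valsum p (addl (y :: ys) E) (updl eps (y :: ys) b') (M p) =
    valsum p (y |: addl ys E) (upd (updl eps ys b) y v) (M p).
  apply: valsum_eq => q _; rewrite /updl /upd inE /b'.
  by case: eqVneq => //= _.
exists b'; split=> [p pZ|z].
  by rewrite upE; apply: nle_trans (bM p pZ); apply: vM.
rewrite upE /b' inE; case: eqVneq => [-> //|_ /= zys].
apply: nle_trans (bb z zys); apply: vM.
by apply: ysZ; rewrite inE zys orbT.
Qed.

Lemma min_priority_sub Y Y' E E' c : min_priority Y E c ->
  {subset Y' <= Y} -> {subset E <= E'} -> min_priority Y' E' c.
Proof.
move=> Yc YY EE y y' h /YY yY /YY y'Y hp /allP hE; apply: (Yc y y') => //.
by apply/allP => q /hE; apply: contra; apply: EE.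
Qed.

(** Here the values [b] are given. Eliminating [y] only increases the right-hand sides at [b], so
    [b] remains postfixed for the remaining equations. *)
Lemma eliminate_gfp ys E c (Z : seq P) M : uniq ys -> {subset ys <= Z} ->
  (forall y, y \in ys -> y \notin E) ->
  ~~ odd c -> min_priority [set y in ys]%SET E c ->
  (forall p, p \in Z -> wtrees p (addl ys E) (M p)) ->
  exists M', (forall p, p \in Z -> wtrees p E (M' p)) /\
  forall eps b,
    (forall y, y \in ys -> b y ⊑ valsum y (addl ys E) (updl eps ys b) (M y)) ->
    forall p, p \in Z ->
      valsum p (addl ys E) (updl eps ys b) (M p) ⊑ valsum p E eps (M' p).
Proof.
move=> + + + oc; elim: ys M => [|y ys IH] M.
  by move=> _ _ _ _ wM; exists M; split=> // eps b _ p _; apply: nle_refl.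
rewrite cons_uniq => /andP[yys uys] ysZ ysE ysc wM.
have yE : y \notin addl ys E.
  by rewrite mem_addl negb_or yys ysE ?mem_head.
have yc : min_priority [set y]%SET (addl ys E) c.
  apply: min_priority_sub ysc _ _ => q; last by rewrite mem_addl => ->; rewrite orbT.
  by rewrite finset.in_set1 => /eqP ->; rewrite !inE eqxx.
have [M1 [wM1 M1P]] := eliminate_gfp1 yE (ysZ y (mem_head _ _)) oc yc wM.
have [|z zys||M2 [wM2 M2P]] := IH M1 uys _ _ _ wM1.
- by move=> z zys; apply: ysZ; rewrite inE zys orbT.
- by apply: ysE; rewrite inE zys orbT.
- apply: min_priority_sub ysc _ _ => // q.
  by rewrite !inE => ->; rewrite orbT.
exists M2; split=> // eps b bM.
have upE p : valsum p (addl (y :: ys) E) (updl eps (y :: ys) b) (M p) =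
    valsum p (y |: addl ys E) (upd (updl eps ys b) y (b y)) (M p).
  by apply: valsum_eq => q _; apply: updl_cons.
have M1le p : p \in Z -> valsum p (addl (y :: ys) E) (updl eps (y :: ys) b) (M p) ⊑
    valsum p (addl ys E) (updl eps ys b) (M1 p).
  by rewrite upE; apply: M1P; rewrite -upE; apply: bM; apply: mem_head.
move=> p pZ; apply: nle_trans (M1le p pZ) _; apply: M2P => // z zys.
have zyys : z \in y :: ys by rewrite inE zys orbT.
by apply: nle_trans (bM z zyys) _; apply: M1le; apply: ysZ.
Qed.

(* [V] is the sum of all winning strategies from [p], as a function of the
   values [eps] of the exits; the finitely many strategies that suffice for the
   upper bound do not depend on these values. *)
Definition solves (X : Type) p E (eps : X -> P -> K) (V : X -> K) :=
  (forall x H, wtree p E H -> val p E (eps x) H ⊑ V x) /\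
  exists Ms, wtrees p E Ms /\ forall x, V x ⊑ valsum p E (eps x) Ms.

Lemma solves_terminal X p E (eps : X -> P -> K) l : nd p = Terminal l ->
  solves p E eps (fun=> pi l).
Proof.
move=> pl; split=> [x H [tH _]|].
  apply: nle_trans (val_le _ (hs := [:: [::]]) _ _) _ => //.
    move=> h; rewrite inE => /eqP ->; split; first exact: tree_nil tH.
    by rewrite /= /terminal pl.
  by rewrite big_seq1 /weight /label /= pl; apply: nle_refl.
exists [:: [set [::]]]; split.
  move=> H; rewrite inE => /eqP ->; split; last first.
    by move=> f [_ /(_ 1%N)].
  split=> //; first by case.
  - by move=> h ->; rewrite /verif /= pl.
  - by case.
  - by move=> h q -> _ _; rewrite /step /= pl.
move=> x; rewrite /valsum big_seq1; apply: val_ge => hs uhs hsl.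
apply: nle_trans (nle_prod_uniq_sub (t := [:: [::]]) _ uhs _).
  by rewrite big_seq1 /weight /label /= pl; apply: nle_refl.
by move=> h /hsl[-> _]; rewrite mem_head.
Qed.

Lemma solves_jump X p E (eps : X -> P -> K) c q : nd p = Prio c q -> q \in E ->
  solves p E eps (fun x => eps x q).
Proof.
move=> pq qE; have sp r : step p r = (r == q) by rewrite /step pq inE.
split=> [x H [tH _]|].
  apply: nle_trans (val_le _ (hs := [:: [:: q]]) _ _) _ => //.
    move=> h; rewrite inE => /eqP ->; split; last by rewrite /= qE.
    apply: (tree_falsif tH (h := [::])) => //; first exact: tree_nil tH.
      by rewrite /verif /= pq.
    by rewrite /= sp.
  by rewrite big_seq1 /weight /label /= qE; apply: nle_refl.
exists [:: [set h | h = [::] \/ h = [:: q]]]; split.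
  move=> H; rewrite inE => /eqP ->; split; last first.
    by move=> f [_ /(_ 2%N)[]].
  split=> /=; first by left.
  - move=> [|r h] r' [] //=; last by case: h.
    by case=> ->; split=> //; [left|rewrite sp].
  - by move=> h [->|->] //=; rewrite ?qE // /verif pq.
  - by move=> [|r h] r1 r2 _ [] // []; [move=> <- [|[]]|case: h].
  - by move=> h r [->|->] /=; rewrite ?qE // sp => _ _ /eqP ->; right.
move=> x; rewrite /valsum big_seq1; apply: val_ge => hs uhs hsl.
apply: nle_trans (nle_prod_uniq_sub (t := [:: [:: q]]) _ uhs _).
  by rewrite big_seq1 /weight /label /= qE; apply: nle_refl.
move=> h /hsl[[->|->] lh]; last exact: mem_head.
by move: lh; rewrite /= /terminal pq.
Qed.

(** A tree at a position of Verifier has one child and its value is bounded by one summand; at a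
    position of Falsifier it has all children, which gives the product. For the finite lists, a
    product of sums is expanded into a sum over the choices of one tree per child. *)
Lemma solves_move X p E (eps : X -> P -> K) (V : X -> P -> K) pl D :
  nd p = Move pl D -> uniq D -> (forall q, q \in D -> q \notin E) ->
  (forall q, q \in D -> solves q E eps (V^~ q)) ->
  solves p E eps (fun x => if pl is Verifier then \sum_(q <- D) V x q
                           else \prod_(q <- D) V x q).
Proof.
move=> pD uD DE sD; have sp r : step p r = (r \in D) by rewrite /step pD.
have tp : ~~ terminal p by rewrite /terminal pD.
have vp : verif p = if pl is Verifier then true else false.
  by rewrite /verif pD; case: (pl).
split=> [x H wH|].
  have subw q : q \in D -> H [:: q] -> val q E (eps x) (sub [:: q] H) ⊑ V x q.
    move=> qD Hq; apply: (sD q qD).1.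
    by apply: (wtree_sub wH Hq) => /=; apply: DE.
  case: pl pD vp => pD vp.
    have [q Hq] := tree_verif wH.1 (tree_nil wH.1) isT vp.
    have qD : q \in D by have [_ _] := tree_rcons wH.1 (h := [::]) Hq; rewrite sp.
    apply: nle_trans (val_children (D := [:: q]) _ wH _ _ _) _ => //.
    - by move=> r; rewrite inE => /eqP ->.
    - by move=> r; rewrite inE => /eqP ->; apply: DE.
    rewrite big_seq1; apply: nle_trans (subw q qD Hq) _.
    exact: (nle_sum_mem (fun q => V x q)).
  have Hq q : q \in D -> H [:: q].
    move=> qD; apply: (tree_falsif wH.1 (h := [::])); rewrite ?vp ?sp //.
    exact: tree_nil wH.1.
  apply: nle_trans (val_children _ wH uD Hq DE) _.
  by rewrite big_seq [X in _ ⊑ X]big_seq; apply: nle_prod => q qD; apply: subw (Hq q qD).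
have [M MP] := choice_seq (fun q qD => (sD q qD).2).
case: pl pD vp => pD vp.
  exists (flatten [seq [seq join [:: q] (fun=> H) | H <- M q] | q <- D]); split.
    move=> _ /flatten_mapP[q qD /mapP[H HM ->]]; apply: wtree_join.
    - by move=> r; rewrite inE => /eqP ->; apply: (MP q qD).1.
    - by move=> r; rewrite inE => /eqP ->; apply: DE.
    - by rewrite vp; exists q; rewrite ?sp.
  move=> x; rewrite /valsum big_flatten big_map big_seq [X in _ ⊑ X]big_seq.
  apply: nle_sum => q qD; apply: nle_trans ((MP q qD).2 x) _.
  rewrite /valsum big_map; apply: nle_sum => H _.
  apply: nle_trans (val_join _ _ tp _ _) => //.
    by rewrite big_seq1; apply: nle_refl.
  by move=> r; rewrite inE => /eqP ->; apply: DE.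
have [cs [csM csE]] := prod_sum_seq set0 M uD.
exists [seq join D s | s <- cs]; split.
  move=> _ /mapP[s scs ->]; apply: wtree_join => //.
    by move=> q qD; apply: (MP q qD).1; apply: csM.
  by rewrite vp => q; rewrite sp.
move=> x; apply: (@nle_trans (\prod_(q <- D) \sum_(H <- M q) val q E (eps x) H)).
  by rewrite big_seq [X in _ ⊑ X]big_seq; apply: nle_prod => q qD; apply: (MP q qD).2.
rewrite csE /valsum big_map; apply: nle_sum => s _; exact: val_join.
Qed.

Lemma sub_cat u h H : sub h (sub u H) = sub (u ++ h) H.
Proof. by apply/funext => k; rewrite /sub /= catA. Qed.

(** * Values at the positions of a fixed-point variable *)

Section FixedPoint.
Variables (X : Type) (E : {set P}) (eps : X -> P -> K) (I : finType) (yy : I -> P)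
  (F : X -> {ffun I -> K} -> {ffun I -> K}) (c : nat).
Hypothesis yy_inj : injective yy.
Hypothesis yyE : forall i, yy i \notin E.
Hypothesis Fmono : forall x g g', fle g g' -> fle (F x g) (F x g').
Let ys := [seq yy i | i <- enum I].
Let Y : {set P} := [set y in ys]%SET.
Hypothesis Yc : min_priority Y E c.

Definition over (ee : P -> K) (g : {ffun I -> K}) q :=
  if [pick i | yy i == q] is Some i then g i else ee q.

Hypothesis Fsolves : forall i, solves (yy i) (Y :|: E)
  (fun xg : X * {ffun I -> K} => over (eps xg.1) xg.2) (fun xg => F xg.1 xg.2 i).

Lemma over_yy ee g i : over ee g (yy i) = g i.
Proof. by rewrite /over; case: pickP => [j /eqP/yy_inj ->|/(_ i)]; rewrite ?eqxx. Qed.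

Lemma over_out ee g q : q \notin ys -> over ee g q = ee q.
Proof.
rewrite /over; case: pickP => // i /eqP <-.
by rewrite map_f // mem_enum.
Qed.

Let YP q : q \in Y -> exists i, q = yy i.
Proof. by rewrite inE => /mapP[i _ ->]; exists i. Qed.

Let YE q : q \in Y -> q \notin E.
Proof. by move=> /YP[i ->]. Qed.

Let ysE q : q \in ys -> q \notin E.
Proof. by move=> qys; apply: YE; rewrite inE. Qed.

Let uys : uniq ys. Proof. by rewrite map_inj_uniq ?enum_uniq. Qed.

Let addlE : addl ys E = Y :|: E.
Proof. by apply/setP => q; rewrite mem_addl finset.in_setU finset.inE. Qed.

(** One unfolding of the fixed point: cut the tree at its first visits to [Y] and apply the upper
    bound known for the body. *)
Lemma val_unfold x (g : {ffun I -> K}) i H : wtree (yy i) E H ->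
  (forall h j, H h -> stopped Y h -> last (yy i) h = yy j ->
     val (last (yy i) h) E (eps x) (sub h H) ⊑ g j) ->
  val (yy i) E (eps x) H ⊑ F x g i.
Proof.
move=> wH leg; apply: (@nle_trans (val (yy i) (Y :|: E) (over (eps x) g) (cut Y H))).
  apply: val_cut => [|q qE|h [Hh _] hY]; first exact: YE.
    rewrite over_out; first exact: nle_refl.
    by apply/negP => qys; have := YE (q := q); rewrite finset.inE qys qE => /(_ isT).
  have [j hj] := YP (stopped_last (yy i) hY).
  by rewrite [X in _ ⊑ over _ _ X]hj over_yy; apply: leg.
exact: ((Fsolves i).1 (x, g) _ (wtree_cut _ wH)).
Qed.

Let stopYE h : stopped Y h -> ~~ stopped E h.
Proof. by case: h => //= q h /YE. Qed.

(** As [g] is part of the parameter of the family in [Fsolves], the same finite lists of trees serve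
    all [g], in particular the fixed points. *)
Let MsP : exists M, (forall p, p \in ys -> wtrees p (addl ys E) (M p)) /\
  forall x g i, F x g i ⊑ valsum (yy i) (addl ys E) (over (eps x) g) (M (yy i)).
Proof.
have [|M MP] := @choice_seq (fun p Ms => wtrees p (addl ys E) Ms /\
    forall x g i, p = yy i -> F x g i ⊑ valsum p (addl ys E) (over (eps x) g) Ms) ys.
  move=> _ /mapP[i _ ->]; have [_ [Ms [wMs leMs]]] := Fsolves i.
  exists Ms; rewrite addlE; split=> // x g j /yy_inj <-.
  exact: (leMs (x, g)).
exists M; split=> [p /MP[]//|x g i].
by have [|_] := MP (yy i); [rewrite map_f ?mem_enum|apply].
Qed.

Let overE x b p M : valsum p (addl ys E) (updl (eps x) ys b) M =
  valsum p (addl ys E) (over (eps x) [ffun i => b (yy i)]) M.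
Proof.
apply: valsum_eq => q _; rewrite /updl; case: ifP => [/mapP[i _ ->]|/negbT qys].
  by rewrite over_yy ffunE.
by rewrite over_out.
Qed.

(** The suprema of the values of winning trees form a postfixed point, because the residual trees at
    visits to [Y] are again winning. Conversely, the greatest fixed point satisfies the inequalities
    required by [eliminate_gfp]. *)
Lemma solves_gfp i : ~~ odd c -> solves (yy i) E eps (fun x => gfp (F x) i).
Proof.
move=> oc; split=> [x H wH|].
  have [s sP] := choice (fun j => sup_exists
    [set v | exists2 H, wtree (yy j) E H & v = val (yy j) E (eps x) H]).
  pose g := [ffun j => s j].
  have gpost : fle g (F x g).
    move=> j; rewrite [g j]ffunE; apply: (sP j).2 => _ [H' wH' ->].
    apply: (val_unfold (wH')) => h k Hh hY hk; rewrite ffunE.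
    apply: (sP k).1; exists (sub h H'); rewrite ?hk // -hk.
    by apply: wtree_sub => //; apply: stopYE.
  apply: nle_trans ((gfpP (@Fmono x)).2 g gpost i).
  by rewrite ffunE; apply: (sP i).1; exists H.
have [M [wM MP]] := MsP.
have [M' [wM' M'P]] := eliminate_gfp uys (fun q qys => qys)
  ysE oc Yc wM.
have iys j : yy j \in ys by rewrite map_f // mem_enum.
exists (M' (yy i)); split; first exact: wM'.
move=> x; pose b q := over (fun=> 0) (gfp (F x)) q.
have gE : [ffun j => b (yy j)] = gfp (F x).
  by apply/ffunP => j; rewrite ffunE /b over_yy.
have leM j : gfp (F x) j ⊑ valsum (yy j) (addl ys E) (updl (eps x) ys b) (M (yy j)).
  by rewrite -{1}(gfpP (@Fmono x)).1 overE gE; apply: MP.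
apply: nle_trans (leM i) _; apply: M'P => //.
by move=> _ /mapP[j _ ->]; rewrite /b over_yy; apply: leM.
Qed.

(* Otherwise some strategy whose value is not below the fixed point has an exit
   in [Y] with the same property, and so on forever, along a play whose least
   recurring priority is the odd [c]. *)
Lemma lfp_upper x i H : odd c -> wtree (yy i) E H ->
  val (yy i) E (eps x) H ⊑ lfp (F x) i.
Proof.
move=> oc wH; apply: contrapT => nle0.
set p := yy i in wH nle0 *; have tH := wH.1.
pose bad u := [/\ H u, u = [::] \/ stopped Y u & exists2 j, last p u = yy j &
  ~ (val (last p u) E (eps x) (sub u H) ⊑ lfp (F x) j)].
have nstop u : bad u -> ~~ stopped E u by move=> [_ [->|/stopYE]].
have next u : exists h, bad u -> h != [::] /\ bad (u ++ h).
  have [bu|] := pselect (bad u); last by exists [::].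
  have uE := nstop u bu; have [Hu _ [j uj nle]] := bu.
  have wu := wtree_sub wH Hu uE.
  apply: contrapT => /forallNP nex; apply: nle; rewrite uj in wu *.
  rewrite -(lfpP (@Fmono x)).1; apply: (val_unfold wu) => h k uh hY hk.
  apply: contrapT => nle; apply: (nex h) => _; split; first by case: (h) hY.
  split=> //; first by right; case/lastP: (h) hY => // h' q; rewrite -rcons_cat !stopped_rcons.
  by exists k; rewrite last_cat uj // -sub_cat.
have [nx nxP] := choice next.
pose us n := iter n (fun u => u ++ nx u) [::].
have bad0 : bad [::] by split=> //; [apply: tree_nil tH|left|exists i].
have busn n : bad (us n).
  by elim: n => // n IH; apply: (nxP _ IH).2.
have usS n m : (n <= m)%N -> exists s, us m = us n ++ s.
  move=> /subnKC <-; elim: (m - n)%N => [|k [s IH]].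
    by exists [::]; rewrite addn0 cats0.
  by exists (s ++ nx (us (n + k)%N)); rewrite addnS /= IH -catA.
have szus n : (n <= size (us n))%N.
  elim: n => // n IH; rewrite /= size_cat.
  have := (nxP _ (busn n)).1; rewrite -size_eq0 -lt0n => s0.
  by rewrite -addn1; apply: leq_add.
(* The limit of the increasing histories [us n]; [us k] has length at least [k], so the default of
   [nth] is not reached. *)
pose f k := nth p (p :: us k) k.
have fE k n : (k <= size (us n))%N -> f k = nth p (p :: us n) k.
  move=> kn; rewrite /f; case/orP: (leq_total k n) => /usS[s e].
    by rewrite e -cat_cons nth_cat /= ltnS szus.
  by rewrite e -cat_cons nth_cat /= ltnS kn.
have bf : branch p H f.
  split=> // n; have -> : mkseq (fun k => f k.+1) n = take n (us n).
    apply: (@eq_from_nth _ p); first by rewrite size_mkseq size_takel.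
    move=> k; rewrite size_mkseq => kn; rewrite nth_mkseq // nth_take //.
    by rewrite (fE _ n) // (leq_trans kn).
  have [Hn _ _] := busn n; apply: (@tree_prefix p E H _ (drop n (us n)) tH).
  by rewrite cat_take_drop.
have fY n : exists2 k, (n <= k)%N & f k \in Y.
  exists (size (us n.+1)); first by rewrite (leq_trans _ (szus _)).
  rewrite (fE _ n.+1) // -last_nth; have [_ [us0|/stopped_last //] _] := busn n.+1.
  by have := szus n.+1; rewrite us0.
have [fc cmin] := recurs_min_priority Yc (fun k => (branch_step k tH bf).1)
  (fun k => (branch_step k tH bf).2) fY.
have [c' [oc' fc' c'min]] := wH.2 f bf.
case: (ltngtP c c') => [/c'min|/cmin|cc'] //.
by rewrite -cc' oc in oc'.
Qed.

(** Elimination yields a prefixed point [g], so the least fixed point is below [g]. Applying [F x]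
    once more puts it below [F x g], hence below the sum over the trees in [M], which [M']
    dominates. *)
Lemma solves_lfp i : odd c -> solves (yy i) E eps (fun x => lfp (F x) i).
Proof.
move=> oc; split=> [x H wH|]; first exact: lfp_upper.
have [M [wM MP]] := MsP.
have [M' [wM' M'P]] := eliminate_lfp uys (fun q qys => qys)
  ysE wM.
have iys j : yy j \in ys by rewrite map_f // mem_enum.
exists (M' (yy i)); split; first exact: wM'.
move=> x; have [b [bM bb]] := M'P (eps x).
pose g := [ffun j => b (yy j)].
have gpre : fle (F x g) g.
  move=> j; rewrite [g j]ffunE; apply: nle_trans (bb _ (iys j)).
  by rewrite overE; apply: MP.
have leg : fle (F x (lfp (F x))) (F x g) by apply: Fmono; apply: (lfpP (@Fmono x)).2.
rewrite (lfpP (@Fmono x)).1 in leg.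
apply: nle_trans (leg i) _.
by apply: nle_trans (bM _ (iys i)); rewrite overE; apply: MP.
Qed.

End FixedPoint.
Lemma solves_move_family X p E (eps : X -> P -> K) (I : eqType) (s : seq I)
    (yy : I -> P) (V : X -> I -> K) pl :
  nd p = Move pl [seq yy i | i <- s] -> uniq s -> injective yy ->
  (forall i, yy i \notin E) -> (forall i, solves (yy i) E eps (V^~ i)) ->
  solves p E eps (fun x => if pl is Verifier then \sum_(i <- s) V x i
                           else \prod_(i <- s) V x i).
Proof.
move=> pD us yyI yyE sV.
pose W x q := if [seq i <- s | yy i == q] is i :: _ then V x i else 0.
have WE x i : i \in s -> W x (yy i) = V x i.
  move=> si; have : i \in [seq j <- s | yy j == yy i] by rewrite mem_filter eqxx.
  rewrite /W; case e : [seq j <- s | _] => [//|j r] _.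
  have : j \in [seq j <- s | yy j == yy i] by rewrite e mem_head.
  by rewrite mem_filter => /andP[/eqP/yyI ->].
have -> : (fun x => if pl is Verifier then \sum_(i <- s) V x i
                    else \prod_(i <- s) V x i) =
    (fun x => if pl is Verifier then \sum_(q <- [seq yy i | i <- s]) W x q
              else \prod_(q <- [seq yy i | i <- s]) W x q).
  apply/funext => x; rewrite !big_map.
  by case: pl {pD}; apply: eq_big_seq => i si; rewrite WE.
apply: solves_move pD _ _ _; first by rewrite map_inj_uniq.
  by move=> _ /mapP[i _ ->].
move=> _ /mapP[i si ->]; have -> : (W^~ (yy i)) = V^~ i; last exact: sV.
by apply/funext => x; rewrite WE.
Qed.

(** * Least priorities on the way to an exit *)

Definition exit_min p h (c : nat) :=
  (forall q k, q \in p :: h -> priority (nd q) = Some k -> (c <= k)%N) /\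
  priority (nd (last p h)) = Some c.

Lemma exit_min_cons p q h c : priority (nd p) = None -> exit_min q h c ->
  exit_min p (q :: h) c.
Proof.
move=> p0 [qc lc]; split=> // r k; rewrite inE => /orP[/eqP ->|]; last exact: qc.
by rewrite p0.
Qed.

Lemma exit_min_cat p h y h' c c' : exit_min p h c -> exit_min y h' c' ->
  (c' <= c)%N -> exit_min p (rcons h y ++ h') c'.
Proof.
move=> [pc _] [yc lc] cc; split; last by rewrite last_cat last_rcons.
move=> q k; rewrite cat_rcons -cat_cons mem_cat => /orP[qh|]; last exact: yc.
by move=> /(pc q k qh); apply: leq_trans.
Qed.

(* [R x k] stands for: [k] is the priority of the exit [x]. *)
Lemma exit_concat Y E c (R : P -> nat -> Prop) :
  (forall x k, R x k -> (k <= c)%N) -> (forall y k, y \in Y -> R y k -> k = c) ->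
  (forall y h x, y \in Y -> path step y (rcons h x) ->
     all (fun q => q \notin Y :|: E) h -> x \in Y :|: E ->
     exists2 k, R x k & exit_min y h k) ->
  forall y h x, y \in Y -> path step y (rcons h x) ->
     all (fun q => q \notin E) h -> x \in Y :|: E ->
     exists2 k, R x k & exit_min y h k.
Proof.
move=> Rc RY piece y h; have [m] := ubnP (size h).
elim: m y h => // m IH y h hm x yY hp hE xE.
have [hY|hY] := boolP (has (fun q => q \in Y) h); last first.
  apply: piece => //; apply/allP => q qh; rewrite finset.in_setU negb_or.
  by rewrite (allP hE) // (hasPn hY).
(* Split at the first visit [y1] to [Y]: [piece] treats the part before it, the induction on the
   length the part after it. *)
case: (split_find hY) hm hp hE => y1 h1 h2 y1Y h1Y hm.
rewrite rcons_cat cat_path last_rcons => /andP[hp1 hp2].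
rewrite all_cat all_rcons => /andP[/andP[_ h1E] h2E].
have h1YE : all (fun q => q \notin Y :|: E) h1.
  apply/allP => q qh; rewrite finset.in_setU negb_or.
  by rewrite (allP h1E) // (hasPn h1Y).
have y1U : y1 \in Y :|: E by rewrite finset.in_setU y1Y.
have [k R1 m1] := piece y h1 y1 yY hp1 h1YE y1U.
rewrite (RY y1 k y1Y R1) in m1.
have [|k2 R2 m2] := IH y1 h2 _ x y1Y hp2 h2E xE.
  by move: hm; rewrite ltnS; apply: leq_trans; rewrite size_cat size_rcons addSn ltnS leq_addl.
by exists k2 => //; apply: exit_min_cat m1 m2 (Rc _ _ R2).
Qed.

End Trees.

(** * Model-checking games *)

Section ModelChecking.
Variables (tau : choiceType) (ar : tau -> nat) (A : finType) (pi : literal ar A -> K).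

Lemma eval_mono V (va : V -> nat) n (f : nform ar va n) (rho : n.-tuple A)
    (e e' : forall v, {ffun (va v).-tuple A -> K}) :
  (forall v, fle (e v) (e' v)) -> eval pi f rho e ⊑ eval pi f rho e'.
Proof.
elim: f rho e e' => {V va n}
  [V va n l|V va n v t|V va n f1 IH1 f2 IH2|V va n f1 IH1 f2 IH2
  |V va n f1 IH1|V va n f1 IH1|V va n k m f1 IH1 t] rho e e' ee /=.
- exact: nle_refl.
- exact: ee.
- by apply: nle_mul; [apply: IH1|apply: IH2].
- by apply: nle_add; [apply: IH1|apply: IH2].
- by apply: nle_sum => a _; apply: IH1.
- by apply: nle_prod => a _; apply: IH1.
have extm (e1 e2 : forall v, {ffun (va v).-tuple A -> K}) (g g' : {ffun m.-tuple A -> K}) :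
    (forall v, fle (e1 v) (e2 v)) -> fle g g' ->
    forall v, fle (ext (F := fun j => {ffun j.-tuple A -> K}) g e1 v)
                  (ext (F := fun j => {ffun j.-tuple A -> K}) g' e2 v).
  by move=> e12 gg [v|] /=.
have er (e1 : forall v, {ffun (va v).-tuple A -> K}) v : fle (e1 v) (e1 v).
  by move=> i; apply: nle_refl.
pose F e1 (g : {ffun m.-tuple A -> K}) : {ffun m.-tuple A -> K} :=
  [ffun a : m.-tuple A => eval pi f1 [tuple of a ++ rho]
     (ext (F := fun j => {ffun j.-tuple A -> K}) g e1)].
have Fmono e1 g g' : fle g g' -> fle (F e1 g) (F e1 g').
  by move=> gg i; rewrite !ffunE; apply: IH1; apply: extm.
have Fee g : fle (F e g) (F e' g).
  by move=> i; rewrite !ffunE; apply: IH1; apply: extm => // i'; apply: nle_refl.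
by case: k; [apply: (lfp_mono (Fmono e) (Fmono e') Fee)|
             apply: (gfp_mono (Fmono e) (Fmono e') Fee)].
Qed.

(** * Subformulae as parts of a game *)

Section Positions.
Variables (P : finType) (nd : P -> node (literal ar A) P).
Local Notation step := (step nd).

(** The copy of [f] inside a larger game. Its free relation variables jump to exits, and among its
    own positions only the root may be an exit, as is the case for the body of a fixed-point
    operator. *)
Definition instance V (va : V -> nat) n (f : nform ar va n) (rho : n.-tuple A)
    (vpr : V -> nat) (jump : forall v, (va v).-tuple A -> P)
    (pr : fpvar f -> nat) (inj : option (inner A f) -> P) (E : {set P}) :=
  [/\ forall p, nd (inj p) = mc_node rho vpr jump pr inj p, injective inj,
      admissible vpr pr, forall v a, jump v a \in E &
      forall p, inj (Some p) \notin E].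

Lemma instance_And V (va : V -> nat) n (f1 f2 : nform ar va n) rho vpr jump pr inj E :
  instance (f := NAnd f1 f2) rho vpr jump pr inj E ->
  instance (f := f1) rho vpr jump (pr \o inl) (inj \o Some \o inl) E /\
  instance (f := f2) rho vpr jump (pr \o inr) (inj \o Some \o inr) E.
Proof.
move=> [nE injI [a1 a2] jE iE]; split.
  by split=> // [p|p q /injI[]|p] //; [apply: (nE (Some (inl p)))|apply: iE].
by split=> // [p|p q /injI[]|p] //; [apply: (nE (Some (inr p)))|apply: iE].
Qed.

Lemma instance_Or V (va : V -> nat) n (f1 f2 : nform ar va n) rho vpr jump pr inj E :
  instance (f := NOr f1 f2) rho vpr jump pr inj E ->
  instance (f := f1) rho vpr jump (pr \o inl) (inj \o Some \o inl) E /\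
  instance (f := f2) rho vpr jump (pr \o inr) (inj \o Some \o inr) E.
Proof.
move=> [nE injI [a1 a2] jE iE]; split.
  by split=> // [p|p q /injI[]|p] //; [apply: (nE (Some (inl p)))|apply: iE].
by split=> // [p|p q /injI[]|p] //; [apply: (nE (Some (inr p)))|apply: iE].
Qed.

Lemma instance_Ex V (va : V -> nat) n (f : nform ar va n.+1) rho vpr jump pr inj E a :
  instance (f := NEx f) rho vpr jump pr inj E ->
  instance (f := f) [tuple of a :: rho] vpr jump pr (fun q => inj (Some (a, q))) E.
Proof.
move=> [nE injI ad jE iE].
by split=> // p q /injI[].
Qed.

Lemma instance_All V (va : V -> nat) n (f : nform ar va n.+1) rho vpr jump pr inj E a :
  instance (f := NAll f) rho vpr jump pr inj E ->
  instance (f := f) [tuple of a :: rho] vpr jump pr (fun q => inj (Some (a, q))) E.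
Proof.
move=> [nE injI ad jE iE].
by split=> // p q /injI[].
Qed.

(** The instantiated bodies of a fixed-point operator, i.e. the targets of the moves from its
    variable. *)
Definition heads (m : nat) (T : finType) (inj : option (m.-tuple A * option T)%type -> P) :
  {set P} := [set q in [seq inj (Some (a, None)) | a <- enum {: m.-tuple A}]]%SET.

Lemma headsP m (T : finType) (inj : option (m.-tuple A * option T)%type -> P) q :
  reflect (exists a, q = inj (Some (a, None))) (q \in heads inj).
Proof.
rewrite inE; apply: (iffP mapP) => [[a _ ->]|[a ->]]; first by exists a.
by exists a; rewrite ?mem_enum.
Qed.

Lemma instance_Fix V (va : V -> nat) n k m (f : nform ar (oapp va m) (m + n)) t
    rho vpr jump pr inj E (a : m.-tuple A) :
  instance (f := NFix k f t) rho vpr jump pr inj E ->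
  instance (f := f) [tuple of a ++ rho] (oapp vpr (pr None))
    (ext (F := fun j => j.-tuple A -> P) (fun a' => inj (Some (a', None))) jump)
    (pr \o Some) (fun q => inj (Some (a, q))) (heads inj :|: E).
Proof.
move=> [nE injI [_ _ ad] jE iE]; split=> //.
- by move=> p q /injI[].
- move=> [v|] b /=; rewrite finset.in_setU; first by rewrite jE orbT.
  by apply/orP; left; apply/headsP; exists b.
- move=> p; rewrite finset.in_setU negb_or iE andbT.
  by apply/headsP => -[b /injI[]].
Qed.

(** The position just before an exit is an occurrence of a free relation variable; its priority is
    the least one on the way. *)
Definition exit_priorities V (va : V -> nat) n (f : nform ar va n) (vpr : V -> nat)
    (jump : forall v, (va v).-tuple A -> P) (E : {set P}) p :=
  forall h x, path step p (rcons h x) -> all (fun q => q \notin E) h -> x \in E ->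
    exists v a, [/\ x = jump v a, occurs f v & exit_min nd p h (vpr v)].

Lemma exit_priorities_move V (va : V -> nat) n (f : nform ar va n) vpr jump (E : {set P})
    p pl D :
  nd p = Move pl D -> (forall q, q \in D -> q \notin E) ->
  (forall q, q \in D -> exists n' (f' : nform ar va n'),
     (forall v, occurs f' v -> occurs f v) /\ exit_priorities f' vpr jump E q) ->
  exit_priorities f vpr jump E p.
Proof.
move=> pD DE Df [|q h] x /=.
  by rewrite /step pD andbT => /DE /negbTE ->.
rewrite {1}/step pD => /andP[qD qh] /andP[_ hE] xE.
have [n' [f' [ff' pf']]] := Df q qD.
have [v [a [xv fv mv]]] := pf' h x qh hE xE; exists v, a; split=> //.
  exact: ff'.
by apply: exit_min_cons => //; rewrite pD.
Qed.

(** By admissibility, the priorities of the outer variables free in the body are at most [pr None].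
    The pieces of a play between successive heads can therefore be concatenated. *)
Lemma exit_priorities_Fix V (va : V -> nat) n k m (f : nform ar (oapp va m) (m + n)) t
    rho vpr jump pr inj E :
  instance (f := NFix k f t) rho vpr jump pr inj E ->
  (forall a, exit_priorities f (oapp vpr (pr None))
     (ext (F := fun j => j.-tuple A -> P) (fun a' => inj (Some (a', None))) jump)
     (heads inj :|: E) (inj (Some (a, None)))) ->
  forall y h x, y \in heads inj -> path step y (rcons h x) ->
    all (fun q => q \notin E) h -> x \in heads inj :|: E ->
    exists v a, [/\ x = ext (F := fun j => j.-tuple A -> P)
        (fun a' => inj (Some (a', None))) jump v a, occurs f v &
      exit_min nd y h (oapp vpr (pr None) v)].
Proof.
move=> [nE injI [_ prm _] jE iE] piece y h x yY hp hE xE.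
pose R x k := exists v a, [/\ x = ext (F := fun j => j.-tuple A -> P)
  (fun a' => inj (Some (a', None))) jump v a, occurs f v &
  k = oapp vpr (pr None) v].
have [|z j zY|z h' x' zY hp' hE' xE'|j [v [a [xv fv ->]]] mj] :=
  @exit_concat _ _ nd (heads inj) E (pr None) R _ _ _ y h x yY hp hE xE.
- by move=> z j [[v|] [a [_ fv ->]]] //=; apply: prm.
- move=> [[v|] [a [zv fv ->]]] //=.
  (* A head cannot be the target of an outer variable, since these targets lie in [E] and heads do
     not. *)
  by move: zY => /headsP[b zb]; move: (iE (b, None)); rewrite -zb zv /= jE.
- move: (zY) hp' => /headsP[b ->] hp'.
  have [v [a [xv fv mv]]] := piece b h' x' hp' hE' xE'.
  by exists (oapp vpr (pr None) v) => //; exists v, a.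
by exists v, a.
Qed.

Lemma instance_exit_priorities V (va : V -> nat) n (f : nform ar va n)
    rho vpr jump pr inj E :
  instance (f := f) rho vpr jump pr inj E -> exit_priorities f vpr jump E (inj None).
Proof.
elim: f rho vpr jump pr inj E => {V va n}
  [V va n l|V va n v t|V va n f1 IH1 f2 IH2|V va n f1 IH1 f2 IH2
  |V va n f1 IH1|V va n f1 IH1|V va n k m f1 IH1 t] rho vpr jump pr inj E ins.
- have [nE _ _ _ _] := ins => -[|q h] x /=; rewrite /step nE //.
- have [nE _ _ jE _] := ins => -[|q h] x /=; rewrite {1}/step nE /= inE.
    move=> /andP[/eqP -> _] _ _; exists v, (inst rho t); split=> //; split.
      by move=> q j; rewrite inE => /eqP ->; rewrite nE /= => -[->].
    by rewrite /= nE.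
  by move=> /andP[/eqP -> _]; rewrite jE.
- have [nE _ _ _ iE] := ins; have [i1 i2] := instance_And ins.
  apply: (exit_priorities_move (nE None)) => q; rewrite !inE => /orP[]/eqP -> //.
    by exists n, f1; split; [left|apply: IH1 i1].
  by exists n, f2; split; [right|apply: IH2 i2].
- have [nE _ _ _ iE] := ins; have [i1 i2] := instance_Or ins.
  apply: (exit_priorities_move (nE None)) => q; rewrite !inE => /orP[]/eqP -> //.
    by exists n, f1; split; [left|apply: IH1 i1].
  by exists n, f2; split; [right|apply: IH2 i2].
- have [nE _ _ _ iE] := ins.
  apply: (exit_priorities_move (nE None)) => q /mapP[a _ ->] //.
  by exists n.+1, f1; split=> //; apply: IH1 (instance_Ex a ins).
- have [nE _ _ _ iE] := ins.
  apply: (exit_priorities_move (nE None)) => q /mapP[a _ ->] //.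
  by exists n.+1, f1; split=> //; apply: IH1 (instance_All a ins).
have [nE _ _ jE iE] := ins; move=> [|y h] x /=.
  by rewrite /step nE /= andbT inE => /eqP -> _; rewrite (negbTE (iE _)).
rewrite {1}/step nE /= inE => /andP[/eqP yE hp] /andP[_ hE] xE.
have yY : y \in heads inj by apply/headsP; exists (inst rho t).
have piece a := IH1 _ _ _ _ _ _ (instance_Fix a ins).
have [|v [a [xv fv mv]]] := exit_priorities_Fix ins piece yY hp hE (x := x).
  by rewrite finset.in_setU xE orbT.
case: v a xv fv mv => [v|] a /= xv fv mv.
  exists v, a; split=> //; apply: exit_min_cons => //; by rewrite nE.
by move: xE; rewrite xv (negbTE (iE _)).
Qed.

(** A segment between two heads ends with the variable of this operator, whose priority [pr None] is
    the least one on the segment and is attained just before the second head. *)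
Lemma instance_min_priority V (va : V -> nat) n k m (f : nform ar (oapp va m) (m + n)) t
    rho vpr jump pr inj E :
  instance (f := NFix k f t) rho vpr jump pr inj E ->
  min_priority nd (heads inj) E (pr None).
Proof.
move=> ins y y' h yY y'Y hp hE.
have piece a := instance_exit_priorities (instance_Fix a ins).
have [|v [a [xv fv [mv lv]]]] := exit_priorities_Fix ins piece yY hp hE.
  by rewrite finset.in_setU y'Y.
have [_ _ _ jE iE] := ins.
case: v a xv fv mv lv => [v|] a /= xv fv mv lv.
  move: y'Y => /headsP[b yb]; move: (iE (b, None)); rewrite -yb xv /=.
  by rewrite jE.
by split=> //; exists (last y h) => //; apply: mem_last.
Qed.

(** Induction on [f], for all parameter types [X] at once: below a fixed-point operator, [X] is
    extended by the function [g] assigned to its variable. *)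
Lemma eval_solves V (va : V -> nat) n (f : nform ar va n) rho vpr jump pr inj E X
    (eps : X -> P -> K) (e : X -> forall v, {ffun (va v).-tuple A -> K}) :
  instance (f := f) rho vpr jump pr inj E ->
  (forall x v a, eps x (jump v a) = e x v a) ->
  solves nd pi (inj None) E eps (fun x => eval pi f rho (e x)).
Proof.
elim: f rho vpr jump pr inj E X eps e => {V va n}
  [V va n l|V va n v t|V va n f1 IH1 f2 IH2|V va n f1 IH1 f2 IH2
  |V va n f1 IH1|V va n f1 IH1|V va n k m f1 IH1 t]
  rho vpr jump pr inj E X eps e ins ee.
- by have [nE _ _ _ _] := ins; apply: solves_terminal (nE None).
- have [nE _ _ jE _] := ins.
  have -> : (fun x => eval pi (NVar ar t) rho (e x)) = (fun x => eps x (jump v (inst rho t))).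
    by apply/funext => x; rewrite ee.
  exact: solves_jump (nE None) _.
- have [nE injI _ _ iE] := ins; have [i1 i2] := instance_And ins.
  pose yy b := inj (Some (if b then inl None else inr None)).
  have := @solves_move_family _ _ nd pi X (inj None) E eps bool [:: true; false] yy
    (fun x b => if b then eval pi f1 rho (e x) else eval pi f2 rho (e x)) Falsifier (nE None).
  rewrite (_ : (fun x => _) = (fun x => eval pi f1 rho (e x) * eval pi f2 rho (e x))); last first.
    by apply/funext => x; rewrite !big_cons big_nil mulr1.
  apply=> //; [by move=> [] [] /injI|by move=> b; apply: iE|].
  by case; [apply: IH1 i1 ee|apply: IH2 i2 ee].
- have [nE injI _ _ iE] := ins; have [i1 i2] := instance_Or ins.
  pose yy b := inj (Some (if b then inl None else inr None)).
  have := @solves_move_family _ _ nd pi X (inj None) E eps bool [:: true; false] yy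
    (fun x b => if b then eval pi f1 rho (e x) else eval pi f2 rho (e x)) Verifier (nE None).
  rewrite (_ : (fun x => _) = (fun x => eval pi f1 rho (e x) + eval pi f2 rho (e x))); last first.
    by apply/funext => x; rewrite !big_cons big_nil addr0.
  apply=> //; [by move=> [] [] /injI|by move=> b; apply: iE|].
  by case; [apply: IH1 i1 ee|apply: IH2 i2 ee].
- have [nE injI _ _ iE] := ins.
  have := @solves_move_family _ _ nd pi X (inj None) E eps A (enum A)
    (fun a => inj (Some (a, None))) (fun x a => eval pi f1 [tuple of a :: rho] (e x))
    Verifier (nE None) (enum_uniq _).
  rewrite (_ : (fun x => _) = (fun x => eval pi (NEx f1) rho (e x))); last first.
    by apply/funext => x; rewrite /= big_enum.
  apply=> //; first by move=> a b /injI[].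
  by move=> a; apply: IH1 (instance_Ex a ins) ee.
- have [nE injI _ _ iE] := ins.
  have := @solves_move_family _ _ nd pi X (inj None) E eps A (enum A)
    (fun a => inj (Some (a, None))) (fun x a => eval pi f1 [tuple of a :: rho] (e x))
    Falsifier (nE None) (enum_uniq _).
  rewrite (_ : (fun x => _) = (fun x => eval pi (NAll f1) rho (e x))); last first.
    by apply/funext => x; rewrite /= big_enum.
  apply=> //; first by move=> a b /injI[].
  by move=> a; apply: IH1 (instance_All a ins) ee.
have [nE injI [oc _ _] jE iE] := ins.
pose yy (a : m.-tuple A) := inj (Some (a, None)).
pose F x (g : {ffun m.-tuple A -> K}) : {ffun m.-tuple A -> K} :=
  [ffun a : m.-tuple A => eval pi f1 [tuple of a ++ rho]
     (ext (F := fun j => {ffun j.-tuple A -> K}) g (e x))].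
have yyI : injective yy by move=> a b /injI[].
have yyE a : yy a \notin E by apply: iE.
have Fmono x g g' : fle g g' -> fle (F x g) (F x g').
  move=> gg a; rewrite !ffunE; apply: eval_mono => -[v|] //= i.
  exact: nle_refl.
have Yc := instance_min_priority ins.
have Fs a : solves nd pi (yy a) (heads inj :|: E)
    (fun xg : X * {ffun m.-tuple A -> K} => over yy (eps xg.1) xg.2)
    (fun xg => F xg.1 xg.2 a).
  have -> : (fun xg : X * {ffun m.-tuple A -> K} => F xg.1 xg.2 a) = (fun xg =>
      eval pi f1 [tuple of a ++ rho]
        (ext (F := fun j => {ffun j.-tuple A -> K}) xg.2 (e xg.1))).
    by apply/funext => xg; rewrite ffunE.
  apply: (IH1 _ _ _ _ _ _ _ _ _ (instance_Fix a ins)) => -[x g] [v|] b /=.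
    rewrite over_out ?ee //; apply/negP => /mapP[b' _ jb].
    by have := jE v b; rewrite jb (negbTE (yyE b')).
  by rewrite (over_yy yyI).
(* The fixed-point formula itself has a forced move to one head, treated as a product with a single
   factor. *)
have := @solves_move_family _ _ nd pi X (inj None) E eps _ [:: inst rho t] yy
  (fun x a => (if k is Lfp then lfp (F x) else gfp (F x)) a) Falsifier (nE None).
rewrite (_ : (fun x => _) = (fun x => eval pi (NFix k f1 t) rho (e x))); last first.
  by apply/funext => x; rewrite big_seq1.
apply=> // a; case: (k) oc => oc.
  exact: (solves_lfp yyI yyE Fmono Yc Fs).
by apply: (solves_gfp yyI yyE Fmono Yc Fs); rewrite oc.
Qed.

End Positions.
End ModelChecking.

(** * From strategy trees to strategies *)

Section Strategies.
Variables (L : choiceType) (G : game L) (pi : L -> K).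
Local Notation P := (position G).
Local Notation nd := (@node_at L G).
Implicit Types (H : set (seq P)) (h : seq P).

Lemma stopped0 h : stopped finset.set0 h = false.
Proof. by case: h => //= q h; rewrite finset.in_set0. Qed.

Lemma prod_pmap (T : Type) (s : seq (option T)) (F : option T -> K) : F None = 1 ->
  \prod_(l <- pmap id s) F (Some l) = \prod_(x <- s) F x.
Proof.
move=> F0; elim: s => [|[l|] s IH] /=; rewrite ?big_nil // !big_cons IH //.
by rewrite F0 mul1r.
Qed.

(** The value of a tree groups leaves by position, that of a strategy by literal, and several
    positions may carry the same literal. Both are infima of the same finite products. *)
Lemma val_outcomes eps H :
  \big[*%R/1]_(l \in [set: L])
     epow (pi l) (ecard [set h | H h /\ nd (last (start G) h) = Terminal l]) =
  val nd pi (start G) finset.set0 eps H.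
Proof.
pose term p := if nd p is Terminal l then Some l else None.
pose ls := undup [seq term p | p <- enum P].
pose lab h := term (last (start G) h).
pose w x := if x is Some l then pi l else 1.
have memls p : term p \in ls by rewrite mem_undup map_f // mem_enum.
have uls : uniq ls by apply: undup_uniq.
pose A := leaf nd (start G) finset.set0 H.
have AE l : A `&` [set h | lab h = Some l] =
    [set h | H h /\ nd (last (start G) h) = Terminal l].
  apply/seteqP; split=> h /=; rewrite /A /leaf /lab /term /terminal /= stopped0.
    by move=> [[Hh _]]; case: nd => // l' [->].
  by move=> [Hh ->].
have -> : \big[*%R/1]_(l \in [set: L])
     epow (pi l) (ecard [set h | H h /\ nd (last (start G) h) = Terminal l]) =
   pval ls lab w A.
  rewrite (fsbigE (pmap id ls)) //=; first last.
  - move=> l _; rewrite mem_pmap => lls.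
    have -> : [set h | H h /\ nd (last (start G) h) = Terminal l] = set0.
      apply/seteqP; split=> // h [_ hl]; move/negP: lls; apply.
      rewrite -[Some l]/(id (Some l)) map_f //.
      by have := memls (last (start G) h); rewrite /term hl.
    by rewrite /ecard asboolT ?fset_set0 ?cardfs0 ?expr0.
  - apply: pmap_uniq uls => x; by case: x.
  under eq_bigl do rewrite in_setT.
  under eq_bigr do rewrite -AE.
  rewrite /pval -(@prod_pmap _ ls (fun x => epow (w x) (ecard (A `&` [set h | lab h = x])))) //.
  by rewrite epow1.
have wE h : A h -> w (lab h) = weight nd pi eps (label (start G) finset.set0 h).
  by move=> _; rewrite /lab /term /weight /label /= stopped0; case: nd.
apply: nle_anti.
  apply: val_ge => hs uhs hsA.
  apply: nle_trans (@pval_le _ _ ls lab uls _ w A hs uhs hsA) _.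
    by move=> h; apply: memls.
  rewrite !big_seq; apply: nle_prod => h hhs; rewrite wE; first exact: nle_refl.
  exact: hsA.
apply: pval_ge => // hs uhs hsA.
apply: nle_trans (@val_le _ _ nd pi (start G) finset.set0 eps H hs uhs hsA) _.
rewrite !big_seq; apply: nle_prod => h hhs; rewrite -wE; first exact: nle_refl.
exact: hsA.
Qed.

Lemma strategy_tree (S : strategy G) :
  tree nd (start G) finset.set0 [set h | consistent S h].
Proof.
split=> /=.
- exact: consistent_nil.
- move=> h q Sq; move e : (rcons h q) Sq => hq Sq.
  case: Sq e => [|h' q' Sh' hq' _]; first by case: h.
  by move=> /rcons_inj[-> ->]; rewrite stopped0.
- move=> h Sh _ vh; exists (S h); apply: consistent_rcons => //.
  exact: choice_legal.
- move=> h q q' vh Sq Sq'.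
  have chosen r : consistent S (rcons h r) -> r = S h.
    move e : (rcons h r) => hr Sr; case: Sr e => [|h' r' _ _ c]; first by case: h {vh Sq Sq'}.
    by move=> /rcons_inj[hh' ->]; rewrite hh' in vh *; apply: c.
  by rewrite (chosen q) // (chosen q').
- move=> h q Sh _ vh hq; apply: consistent_rcons => // vh'.
  by rewrite /verif (_ : verifier_node _) in vh.
Qed.

Lemma tree_strategy H : tree nd (start G) finset.set0 H ->
  exists S : strategy G, [set h | consistent S h] = H.
Proof.
(* At Verifier's positions within [H] this is the unique successor in [H]; elsewhere any value is
   legal. *)
move=> tH; pose s h := xget (start G) [set q | H (rcons h q)].
have sP h : H h -> is_verifier (current h) -> H (rcons h (s h)).
  move=> Hh vh; apply: (@xgetPex _ (start G) [set q | H (rcons h q)]).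
  by apply: (tree_verif tH) => //; rewrite stopped0.
have sE h : consistent s h <-> H h.
  split.
    elim=> [|h' q _ Hh hq qs]; first exact: tree_nil tH.
    have [vh|vh] := boolP (is_verifier (current h')).
      by rewrite (qs vh); apply: sP.
    by apply: (tree_falsif tH) => //; rewrite stopped0.
  elim/last_ind: h => [|h q IH] Hq; first exact: consistent_nil.
  have [Hh _ hq] := tree_rcons tH Hq.
  apply: consistent_rcons => //; first exact: IH.
  by move=> vh; apply: (tree_verif_uniq tH vh Hq); apply: sP.
have legal h : consistent s h -> is_verifier (current h) -> edge (current h) (s h).
  by move=> /sE Hh vh; have [_ _] := tree_rcons tH (sP h Hh vh).
by exists (Strategy legal); apply/seteqP; split=> h /sE.
Qed.

Lemma strategy_value_tree (S : strategy G) eps :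
  wtree nd (start G) finset.set0 [set h | consistent S h] ->
  strategy_value S pi = val nd pi (start G) finset.set0 eps [set h | consistent S h].
Proof.
move=> [_ wS]; rewrite /strategy_value asboolT; first by rewrite -val_outcomes.
by move=> f; apply: wS.
Qed.

(** Strategies that admit a lost infinite play have value [0], so only winning trees matter for
    upper bounds. *)
Lemma strategy_value_le (S : strategy G) eps v :
  (forall H, wtree nd (start G) finset.set0 H ->
     val nd pi (start G) finset.set0 eps H ⊑ v) -> strategy_value S pi ⊑ v.
Proof.
move=> le_v; have [wS|nwS] := pselect (forall f, infinite_play S f -> won_by_verifier f).
  have wS' : wtree nd (start G) finset.set0 [set h | consistent S h].
    by split; [apply: strategy_tree|move=> f; apply: wS].
  by rewrite (strategy_value_tree eps wS'); apply: le_v.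
by rewrite /strategy_value asboolF //; apply: nle0.
Qed.

End Strategies.

End SumOfStrategies.

Local Close Scope ring_scope.

Theorem theorem34
    (tau : choiceType) (ar : tau -> nat) (A : finType)
    (K : comPzSemiRingType)
    (Knat : naturally_ordered K) (Kabs : absorptive K)
    (Kcont : fully_continuous K)
    (pi : literal ar A -> K) (pi_interp : interpretation pi)
    (n : nat) (psi : LFP ar n) (rho : n.-tuple A)
    (pr : fpvar (nnf true psi) -> nat) (pr_adm : admissible_priorities pr) :
  is_sup [set strategy_value S pi | S in [set: Strat rho pr]]
         (prov pi psi rho).
Proof.
pose G := mc_game rho pr.
(* The whole game is the instance of a formula without free relation variables, hence with no
   exits. *)
have ins : instance (@node_at _ G) (f := nnf true psi) rho (of_none _) (of_none _)
    pr id finset.set0.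
  by split=> // [[]|q]; rewrite finset.in_set0.
have [|ub [Ms [wMs le_Ms]]] := eval_solves Kabs Kcont pi (X := unit)
    (eps := fun _ _ => 0%R) (e := fun=> of_none _) ins.
  by move=> x [].
split=> [_ [S _ <-]|u uub].
  exact: strategy_value_le (fun H => ub tt H).
(* The value is below a finite sum of values of winning strategies, and in an absorptive semiring
   finite sums are least upper bounds. *)
apply: nle_trans (le_Ms tt) _; rewrite /valsum big_seq; apply: nle_sum_lub => // H HMs.
have wH := wMs H HMs.
have [S SH] := tree_strategy wH.1.
rewrite -SH in wH *; rewrite -strategy_value_tree //; apply: uub.
by exists S.
Qed.
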